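(* Let $k\ge0$ be an integer, $h>0$, $\Delta t>0$, and assume the stability condition $\max_\xi\sigma_m(\xi)\le \frac{4}{(\Delta t)^2}$ for all branches $m\in\{ph,(sp,1),\dots,(sp,k)\}$. The group velocities $v_g^m(\xi):=\frac{d\omega_m(\xi)}{d\xi}$ of the fully discrete $P^k$-LDG scheme exhibit the following asymptotic behaviors (limits at $\pm\frac{\pi}{h}$ taken from inside $\Pi_h=[-\frac\pi h,\frac\pi h]$). (1) For the physical mode: $$\lim_{\xi\to0}v_g^{ph}(\xi)=1,\qquad \lim_{\xi\to\pm\frac{\pi}{h}}v_g^{ph}(\xi)=\begin{cases}1,&\text{if }(k,\Delta t)=(0,h),\\ 0,&\text{otherwise.}\end{cases}$$ (2) For the spurious modes, provided $|\omega_{sp,i}|\ne\frac{\pi}{\Delta t}$ at these limits: $$\lim_{\xi\to0^\pm}v_g^{sp,i}(\xi)=0,\qquad \lim_{\xi\to\pm\frac{\pi}{h}}v_g^{sp,i}(\xi)=0,\qquad i=1,\dots,k.$$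
   Context: Mesh: $h>0$, $x_j=jh$, $x_{j+1/2}=(j+\tfrac12)h$, $I_j=(x_{j-1/2},x_{j+1/2})$, $j\in\mathbb Z$. $V_h^k=\{v\in L^2(\mathbb R): v|_{I_j}\in P^k(I_j)\ \forall j\}$, with $P^k(I_j)$ the polynomials of degree at most $k$. On $I_j$ a function $u_h\in V_h^k$ is written in the monomial basis $\phi_{j,l}(x)=\big(\tfrac{x-x_j}{h/2}\big)^l$, $l=0,\dots,k$, with coefficient vector $\bm u_j\in\mathbb C^{k+1}$. Superscripts $\pm$ denote right/left limits at interfaces. Local LDG matrices (alternating fluxes $\widetilde u_h=u_h^-$, $\widetilde q_h=q_h^+$): given $u_h$, the auxiliary variable $q_h\in V_h^k$ is defined by $$\int_{I_j} q_h v\,dx=-\int_{I_j}u_hv_x\,dx+(u_h)^-_{j+1/2}v^-_{j+1/2}-(u_h)^-_{j-1/2}v^+_{j-1/2}\qquad\forall v\in P^k(I_j),\ j\in\mathbb Z.$$ The mass matrix is $\bm M^h=\big(\int_{I_j}\phi_{j,l}\phi_{j,m}\,dx\big)_{l,m=0}^k$, and the real stiffness blocks $\bm K^h_{-1},\bm K^h_0,\bm K^h_{+1}$ are defined by $$\big(\bm K^h_{-1}\bm u_{j-1}+\bm K^h_0\bm u_j+\bm K^h_{+1}\bm u_{j+1}\big)_l=\int_{I_j}q_h(\phi_{j,l})_x\,dx-(q_h)^+_{j+1/2}(\phi_{j,l})^-_{j+1/2}+(q_h)^+_{j-1/2}(\phi_{j,l})^+_{j-1/2}.$$ The symbol is $\mathcal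 K^h(\xi)=\bm K^h_0+\bm K^h_{-1}e^{-\sqrt{-1}\,\xi h}+\bm K^h_{+1}e^{\sqrt{-1}\,\xi h}$. The fully discrete scheme (time step $\Delta t$, central differences) is $\bm M^h\frac{\bm u_j^{n+1}-2\bm u_j^n+\bm u_j^{n-1}}{(\Delta t)^2}+\bm K_0^h\bm u_j^n+\bm K_{-1}^h\bm u_{j-1}^n+\bm K_{+1}^h\bm u_{j+1}^n=0$. Modes: the problem $(\mathcal K^h(\xi)-\sigma\bm M^h)\bm v=\bm0$, $\xi\in\Pi_h$, has $k+1$ real-analytic eigenpairs with real nonnegative eigenvalues, even in $\xi$, forming an $\bm M^h$-orthonormal basis. The unique branch with $\sigma(0)=0$ is the physical branch $(\sigma_{ph},\bm v_{ph})$; the other $k$ branches $(\sigma_{sp,i},\bm v_{sp,i})$, which satisfy $\sigma_{sp,i}(0)>0$, are the spurious ones. The discrete temporal frequencies are $$\omega_m(\xi)=\mathrm{sign}(\xi)\,\frac{2}{\Delta t}\arcsin\Big(\frac{\sqrt{\sigma_m(\xi)}\,\Delta t}{2}\Big),\qquad m\in\{ph,(sp,1),\dots,(sp,k)\}.$$ In (2), the proviso at $\xi\to0^\pm$ (resp. at $\pm\pi/h$) refers to the limiting value of $|\omega_{sp,i}|$ at that point. *)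

(* Defs.v *)
From HB Require Import structures.
From mathcomp Require Import all_boot all_order all_algebra.
From mathcomp Require Import complex.
From mathcomp Require Import all_classical all_reals all_analysis.
Set Implicit Arguments.
Unset Strict Implicit.
Unset Printing Implicit Defensive.
Import Order.TTheory GRing.Theory Num.Theory.
Import numFieldNormedType.Exports.
Local Open Scope classical_set_scope.
Local Open Scope ring_scope.
Local Open Scope complex_scope.

(* Uniform mesh: interface h j is x_{j+1/2}, so that the cell I_j is
   ]interface h (j - 1), interface h j[. *)
Definition node (R : realType) (h : R) (j : int) : R := j%:~R * h.

Definition interface (R : realType) (h : R) (j : int) : R :=
  (j%:~R + 2^-1) * h.

Definition cell (R : realType) (h : R) (j : int) : set R :=
  `]interface h (j - 1), interface h j[.

(* Integral over I_j of a complex polynomial in the real variable x. *)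
Definition cell_int (R : realType) (h : R) (j : int) (p : {poly R[i]}) : R[i] :=
  (\int[@lebesgue_measure R]_(x in cell h j) complex.Re p.[x%:C])
  +i* (\int[@lebesgue_measure R]_(x in cell h j) complex.Im p.[x%:C]).

Definition phi (R : realType) (h : R) (j : int) (l : nat) : {poly R} :=
  ((2 / h) *: ('X - (node h j)%:P)) ^+ l.

Definition phiC (R : realType) (h : R) (j : int) (l : nat) : {poly R[i]} :=
  map_poly (real_complex R) (phi h j l).

(* A function of the DG space of degree k is represented by the family
   u : int -> {poly R[i]} of its restrictions to the cells (as polynomials in
   the global variable x).  Its one-sided limits at an interface are then the
   values there of the polynomials of the two adjacent cells. *)
Definition trace_minus (R : realType) (h : R) (u : int -> {poly R[i]})
  (j : int) : R[i] := (u j).[(interface h j)%:C].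

Definition trace_plus (R : realType) (h : R) (u : int -> {poly R[i]})
  (j : int) : R[i] := (u (j + 1)).[(interface h j)%:C].

Definition dg_function (R : realType) (k : nat) (h : R)
    (u : int -> 'cV[R[i]]_k.+1) : int -> {poly R[i]} :=
  fun j => \sum_(l < k.+1) u j l 0 *: phiC h j l.

Definition is_auxiliary (R : realType) (k : nat) (h : R)
    (u q : int -> {poly R[i]}) : Prop :=
  (forall j : int, (size (q j) <= k.+1)%N) /\
  (forall (j : int) (v : {poly R[i]}), (size v <= k.+1)%N ->
     cell_int h j (q j * v) =
       - cell_int h j (u j * v^`())
       + trace_minus h u j * v.[(interface h j)%:C]
       - trace_minus h u (j - 1) * v.[(interface h (j - 1))%:C]).

(* By translation invariance the mass matrix does not depend on the cell;
   it is computed on I_0. *)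
Definition mass_mx (R : realType) (k : nat) (h : R) : 'M[R]_k.+1 :=
  \matrix_(l, m) \int[@lebesgue_measure R]_(x in cell h 0)
                    ((phi h 0 l).[x] * (phi h 0 m).[x]).

Definition mxC (R : realType) (m n : nat) (A : 'M[R]_(m, n)) : 'M[R[i]]_(m, n) :=
  map_mx (real_complex R) A.

(* Km1, K0, Kp1 are the three real stiffness blocks of the LDG operator with
   fluxes u^- and q^+; this identity determines them. *)
Definition stiffness_blocks (R : realType) (k : nat) (h : R)
    (Km1 K0 Kp1 : 'M[R]_k.+1) : Prop :=
  forall (u : int -> 'cV[R[i]]_k.+1) (q : int -> {poly R[i]}),
    is_auxiliary k h (dg_function h u) q ->
    forall (j : int) (l : 'I_k.+1),
      (mxC Km1 *m u (j - 1) + mxC K0 *m u j + mxC Kp1 *m u (j + 1)) l 0 =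
        cell_int h j (q j * (phiC h j l)^`())
        - trace_plus h q j * (phiC h j l).[(interface h j)%:C]
        + trace_plus h q (j - 1) * (phiC h j l).[(interface h (j - 1))%:C].

Definition expi (R : realType) (t : R) : R[i] := cos t +i* sin t.

Definition symbol (R : realType) (k : nat) (h : R) (Km1 K0 Kp1 : 'M[R]_k.+1)
    (xi : R) : 'M[R[i]]_k.+1 :=
  mxC K0 + expi (- (xi * h)) *: mxC Km1 + expi (xi * h) *: mxC Kp1.

Definition Brillouin (R : realType) (h : R) : set R :=
  `[- (pi / h), pi / h].

(* Only the values of f on A matter: near each point of A (endpoints included)
   f coincides on A with the sum of a convergent power series. *)
Definition real_analytic_on (R : realType) (A : set R) (f : R -> R) : Prop :=
  forall x, A x -> exists (a : nat -> R) (r : R), 0 < r /\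
    (forall y, A y -> `|y - x| < r ->
       series (fun n => a n * (y - x) ^+ n) @ \oo --> f y).

Definition mode (k : nat) : Type := option 'I_k.
Definition ph (k : nat) : mode k := None.
Definition sp (k : nat) (i : 'I_k) : mode k := Some i.

Record eigenbranches (R : realType) (k : nat) (h : R)
    (Km1 K0 Kp1 : 'M[R]_k.+1)
    (sigma : mode k -> R -> R) (v : mode k -> R -> 'cV[R[i]]_k.+1) : Prop := {
  sigma_analytic : forall m, real_analytic_on (Brillouin h) (sigma m) ;
  v_analytic : forall m l,
    real_analytic_on (Brillouin h) (fun xi => complex.Re (v m xi l 0)) /\
    real_analytic_on (Brillouin h) (fun xi => complex.Im (v m xi l 0)) ;
  sigma_ge0 : forall m xi, Brillouin h xi -> 0 <= sigma m xi ;
  sigma_even : forall m xi, Brillouin h xi -> sigma m (- xi) = sigma m xi ;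
  eigen_eq : forall m xi, Brillouin h xi ->
    (symbol h Km1 K0 Kp1 xi - (sigma m xi)%:C *: mxC (mass_mx k h))
      *m v m xi = 0 ;
  v_orthonormal : forall m n xi, Brillouin h xi ->
    (map_mx conjc (v m xi))^T *m mxC (mass_mx k h) *m v n xi =
      ((if m == n :> option 'I_k then 1 else 0) : R[i])%:M ;
  sigma_ph0 : sigma (ph k) 0 = 0 ;
  sigma_sp0 : forall i, 0 < sigma (sp i) 0
}.

Definition omega (R : realType) (dt : R) (sigma : R -> R) (xi : R) : R :=
  Num.sg xi * (2 / dt) * asin (Num.sqrt (sigma xi) * dt / 2).

(* The group velocity derive1 w tends to l along F.  Since derive1 is a total
   operator, the existence of the derivative near the limit is required too. *)
Definition group_velocity_cvg (R : realType) (w : R -> R) (F : set_system R)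
    (l : R) : Prop :=
  (\forall xi \near F, derivable w xi 1) /\ derive1 w xi @[xi --> F] --> l.

(* Main.v *)
Require Import Defs.
From mathcomp Require Import all_boot all_order all_algebra.
From mathcomp Require Import complex.
From mathcomp Require Import all_classical all_reals all_analysis.
From mathcomp Require Import ring lra.
Import Order.TTheory GRing.Theory Num.Theory.
Import numFieldNormedType.Exports.
Local Open Scope classical_set_scope.
Local Open Scope ring_scope.
Set Implicit Arguments.
Unset Strict Implicit.
Unset Printing Implicit Defensive.

(** Why the theorem holds.

    Plane waves reduce the scheme to one cell.  Write [z = expi (xi * h)] and
    let [U], [Q] be the polynomials of [u_h] and [q_h] on the cell [I_0], with
    [I] the integral over that cell and [xl], [xr] its ends.  An eigenpair of
    the symbol is exactly a solution of
      [I (Q V) = I (U' V) + a V(xl)],       [a = U(xl) - conj z U(xr)],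
      [sigma I (U V) = - I (Q' V) + b V(xr)], [b = Q(xr) - z Q(xl)],
    for all [V] of degree at most [k] (the record [bloch]).  Everything rests on
    four facts about this system.

    - Upwinding produces exactly the jump: testing the second equation with
      [conj Q] and adding the conjugate gives [2 Re (sigma I (U conj Q)) = |b|^2],
      since [|z| = 1] ([flux_identity]).  If [a = 0] then [Q = U'] and the left
      side is [sigma (|U(xr)|^2 - |U(xl)|^2) = 0]; so [b = 0] as well, hence
      [sigma U = - U''] and [U = 0] when [sigma != 0] ([bloch_simple]).
      Consequently the jump [a] is a faithful coordinate on the eigenspace: a
      nonzero eigenvalue is simple, and two branches never meet at a positive
      value ([sigma_inj]).  The eigenvalue 0 forces [U] constant and [z = 1]
      ([bloch_zero]), so all branches are positive away from [xi = 0].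

    - Subtracting the equations at two frequencies ([bloch_difference]) yields a
      Hellmann-Feynman formula for [sigma'] which uses only the continuity of
      the eigenvectors ([sigma_derive]).  Where [z] is real, [conj U] solves the
      same system as [U], so by simplicity they are proportional and the two
      terms of the formula cancel: [sigma' = 0] at [xi = 0] and at
      [xi = pi / h] unless [sigma = 0] there ([slope_real_phase]).

    - For the physical branch at [xi = 0], [U] is a constant [c] and [Q = 0].
      The rescaled limit [r0] of [Q / xi] satisfies the second equation with
      [sigma = 0] and [z = 1], so it is constant, and the mean of the first
      equation identifies it as ['i c].  This gives [sigma ~ xi^2] and
      [sigma' ~ 2 xi] ([sigma_ph_equiv], [slope_ph_equiv]).

    - By the intermediate value theorem the branches keep their order on
      [(0, pi / h]], so for [k > 0] the physical branch ends strictly below a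
      spurious one and thus strictly below the stability bound; for [k = 0] its
      end value is [4 / h^2].  Only for [(k, dt) = (0, h)] does the physical
      branch reach the bound at [pi / h], and then [omega xi = xi].

    The group velocity is
    [sgn xi * sigma' / (2 sqrt sigma sqrt (1 - sigma dt^2 / 4))]
    ([omega_derive]); the denominator has a nonzero limit except when
    [sigma -> 0] or [sigma -> 4 / dt^2], and the proviso on
    [lim |omega| <> pi / dt] excludes the second case ([omega_lim]). *)

(** * Integrals of polynomials over a cell *)

Section CellIntegral.
Context {R : realType} (h : R).
Hypothesis h_gt0 : 0 < h.
Local Open Scope complex_scope.
Local Notation C := R[i].
Implicit Types p q : {poly C}.

(** Every polynomial is a derivative, so that facts about cell integrals can be
    checked on derivatives, where [cell_int_deriv] evaluates them. *)
Lemma poly_primitive (F : numFieldType) (p : {poly F}) :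
  exists P : {poly F}, P^`() = p.
Proof.
exists (\poly_(i < (size p).+1) (p`_i.-1 / i%:R)).
apply/polyP => i; rewrite coef_deriv coef_poly ltnS /=.
case: ltnP => [_|ip]; last by rewrite mul0rn nth_default.
by rewrite -[_ *+ i.+1]mulr_natr mulfVK// pnatr_eq0.
Qed.

Lemma Rintegral_deriv (P : {poly R}) (a b : R) : a < b ->
  \int[@lebesgue_measure R]_(x in `]a, b[) P^`().[x] = P.[b] - P.[a].
Proof.
move=> ab.
have cP (p : {poly R}) : {within `[a, b], continuous (horner p)}.
  by apply: continuous_subspaceT; exact: continuous_horner.
have ip : (@lebesgue_measure R).-integrable `[a, b]
    (EFin \o (fun x => P^`().[x])).
  by apply: continuous_compact_integrable; [exact: segment_compact|exact: cP].
rewrite Rintegral_itv_bndo_bndc; last first.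
  by apply: integrableS ip => // x; apply: subset_itv; rewrite bnd_simp.
rewrite Rintegral_itv_obnd_cbnd; last first.
  by apply: integrableS ip => // x; apply: subset_itv; rewrite bnd_simp.
rewrite /Rintegral (@continuous_FTC2 _ _ (horner P))//.
- split.
  + by move=> x _; exact: derivable_horner.
  + by apply: cvg_at_right_filter; exact: continuous_horner.
  + by apply: cvg_at_left_filter; exact: continuous_horner.
- by move=> x _; rewrite -derivE.
Qed.

Lemma interface_lt j : interface h (j - 1) < interface h j.
Proof. by rewrite /interface ltr_pM2r// ltrD2r ltr_int gtrBl. Qed.

Lemma Re_horner p (x : R) :
  complex.Re p.[x%:C] = (map_poly (@complex.Re R) p).[x].
Proof.
rewrite horner_coef horner_poly raddf_sum /=; apply: eq_bigr => i _.
by rewrite -rmorphXn /=; case: (p`_i) => a b /=; rewrite mulr0 subr0.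
Qed.

Lemma Im_horner p (x : R) :
  complex.Im p.[x%:C] = (map_poly (@complex.Im R) p).[x].
Proof.
rewrite horner_coef horner_poly raddf_sum /=; apply: eq_bigr => i _.
by rewrite -rmorphXn /=; case: (p`_i) => a b /=; rewrite mulr0 add0r.
Qed.

Lemma cell_int_deriv j p :
  cell_int h j p^`() = p.[(interface h j)%:C] - p.[(interface h (j - 1))%:C].
Proof.
rewrite /cell_int /cell.
have eR : (fun x : R => complex.Re p^`().[x%:C]) =
    (fun x => (map_poly (@complex.Re R) p)^`().[x]).
  apply/funext => x; rewrite Re_horner; congr _.[x]; apply/polyP => i.
  by rewrite coef_deriv !coef_map coef_deriv raddfMn.
have eI : (fun x : R => complex.Im p^`().[x%:C]) =
    (fun x => (map_poly (@complex.Im R) p)^`().[x]).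
  apply/funext => x; rewrite Im_horner; congr _.[x]; apply/polyP => i.
  by rewrite coef_deriv !coef_map coef_deriv raddfMn.
rewrite eR eI !Rintegral_deriv ?interface_lt//.
rewrite -!Re_horner -!Im_horner.
by case: (p.[_]) => a b; case: (p.[_]) => c d.
Qed.

Lemma cell_intD j p q : cell_int h j (p + q) = cell_int h j p + cell_int h j q.
Proof.
have [[P <-] [Q <-]] := (poly_primitive p, poly_primitive q).
by rewrite -derivD !cell_int_deriv !hornerD opprD addrACA.
Qed.

Lemma cell_intZ j c p : cell_int h j (c *: p) = c * cell_int h j p.
Proof.
have [P <-] := poly_primitive p.
by rewrite -derivZ !cell_int_deriv !hornerZ mulrBr.
Qed.

Lemma cell_int_conj j p :
  cell_int h j (map_poly conjc p) = conjc (cell_int h j p).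
Proof.
have [P <-] := poly_primitive p.
rewrite -deriv_map !cell_int_deriv rmorphB /= -!horner_map /=.
by rewrite /real_complex_def oppr0.
Qed.

(** Translation invariance reduces every cell to [I_0]. *)
Lemma cell_int_shift j p :
  cell_int h j (p \Po ('X - (node h j)%:C%:P)) = cell_int h 0 p.
Proof.
have [P <-] := poly_primitive p.
have -> : P^`() \Po ('X - (node h j)%:C%:P) = (P \Po ('X - (node h j)%:C%:P))^`().
  by rewrite deriv_comp derivB derivX derivC subr0 mulr1.
rewrite !cell_int_deriv !horner_comp !hornerE -!rmorphB.
congr (P.[_%:C] - P.[_%:C]); rewrite /interface /node; first by ring.
by rewrite !intrD; ring.
Qed.

End CellIntegral.

(** * The duality pairing on one cell *)

Section BlochAlgebra.
Context {R : realType} (k : nat) (h : R).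
Hypothesis h_gt0 : 0 < h.
Local Open Scope complex_scope.
Local Notation C := R[i].
Local Notation I := (cell_int h 0).
Local Notation xr := ((interface h 0)%:C).
Local Notation xl := ((interface h (0 - 1))%:C).
Local Notation cj := (map_poly conjc).
Implicit Types (p q D U V : {poly C}) (c : C).

Lemma poly_zero_on_itv (p : {poly R}) (a b : R) : a < b ->
  {in `[a, b], forall x, p.[x] = 0} -> p = 0.
Proof.
move=> ab p0; (* More roots in the interval than the size of [p] allows. *)
pose s := [seq a + (b - a) / (i.+1%:R) | i <- iota 0 (size p)].
apply: (@roots_geq_poly_eq0 _ p s); last by rewrite size_map size_iota.
  apply/allP => _ /mapP[i _ ->]; apply/rootP/p0; rewrite in_itv /=.
  have ba : 0 < b - a by rewrite subr_gt0.
  rewrite lerDl divr_ge0 ?(ltW ba)//= addrC -lerBrDr ler_piMr ?(ltW ba)//.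
  by rewrite invf_le1 ?ler1n.
rewrite map_inj_uniq ?iota_uniq// => i j /addrI/mulfI.
have /[swap]/[apply] : b - a != 0 by rewrite subr_eq0 gt_eqF.
by move/invr_inj/eqP; rewrite eqr_nat eqSS => /eqP.
Qed.

(** The integrand [|p|^2] is a real nonnegative polynomial [s]; a primitive of
    [s] is nondecreasing with equal values at both ends, hence constant. *)
Lemma cell_int_definite p : I (p * cj p) = 0 -> p = 0.
Proof.
pose a := map_poly (@complex.Re R) p.
pose b := map_poly (@complex.Im R) p.
pose s := a ^+ 2 + b ^+ 2.
have [P dP] := poly_primitive s.
have e : p * cj p = map_poly (real_complex R) s.
  have pc : p = map_poly (real_complex R) a + ('i)%C *: map_poly (real_complex R) b.
    apply/polyP => i; rewrite coefD coefZ !coef_map.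
    by case: (p`_i) => u v /=; simpc.
  have pcj : cj p = map_poly (real_complex R) a - ('i)%C *: map_poly (real_complex R) b.
    apply/polyP => i; rewrite coefB coefZ !coef_map.
    by case: (p`_i) => u v /=; simpc.
  rewrite mulrC pcj {1}pc -subr_sqr exprZn sqr_i scaleN1r opprK.
  by rewrite /s rmorphD /= !rmorphXn.
rewrite e -dP -deriv_map cell_int_deriv// !horner_map /= -rmorphB.
move/complexI/eqP; rewrite subr_eq0 => /eqP Prl.
have lr := interface_lt h_gt0 0.
have s_ge0 x : 0 <= s.[x] by rewrite /s hornerD !horner_exp addr_ge0// sqr_ge0.
have ndP : {in `[interface h (0 - 1), interface h 0] &,
    {homo (horner P) : x y / x <= y}}.
  apply: ger0_derive1_le_cc => [x _|x _|].
  - exact: derivable_horner.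
  - by rewrite -derivE dP.
  - by apply: continuous_subspaceT; exact: continuous_horner.
have Pc : P - P.[interface h 0]%:P = 0.
  apply: (poly_zero_on_itv lr) => x xlr.
  rewrite !hornerE; apply/eqP; rewrite subr_eq0 eq_le.
  have := xlr; rewrite in_itv /= => /andP[lx xr].
  rewrite ndP//= ?in_itv/= ?lexx ?(ltW lr)//.
  by rewrite Prl ndP//= in_itv/= lexx (ltW lr).
have s0 : s = 0 by rewrite -dP -(subrK P.[interface h 0]%:P P) Pc add0r derivC.
have ab0 x : a.[x] = 0 /\ b.[x] = 0.
  have /eqP : s.[x] = 0 by rewrite s0 horner0.
  rewrite /s hornerD !horner_exp paddr_eq0 ?sqr_ge0// !sqrf_eq0.
  by move=> /andP[/eqP-> /eqP->].
have a0 : a = 0 by apply: (poly_zero_on_itv lr) => x _; have [] := ab0 x.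
have b0 : b = 0 by apply: (poly_zero_on_itv lr) => x _; have [] := ab0 x.
apply/polyP => i; rewrite coef0.
have := congr1 (fun q : {poly R} => q`_i) a0; have := congr1 (fun q : {poly R} => q`_i) b0.
rewrite !coef_map !coef0.
by case: (p`_i) => u v /= -> ->.
Qed.

Lemma size_cj p : size (cj p) = size p.
Proof. exact: size_map_poly. Qed.

Lemma cjK p : cj (cj p) = p.
Proof. by apply/polyP => i; rewrite !coef_map /= conjcK. Qed.

Lemma horner_cj p (x : R) : (cj p).[x%:C] = conjc p.[x%:C].
Proof. by rewrite -horner_map /= /real_complex_def oppr0. Qed.

Lemma pairing_nondeg p : (size p <= k.+1)%N ->
  (forall V, (size V <= k.+1)%N -> I (p * V) = 0) -> p = 0.
Proof. by move=> sp pV; apply: cell_int_definite; rewrite pV// size_cj. Qed.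

Lemma cell_int0 : I 0 = 0.
Proof. by rewrite -(scale0r 0) cell_intZ// mul0r. Qed.

Lemma cell_intB p q : I (p - q) = I p - I q.
Proof. by rewrite -scaleN1r cell_intD// cell_intZ// mulN1r. Qed.

Lemma cell_int_sum (T : Type) (r : seq T) (P : pred T) (F : T -> {poly C}) :
  I (\sum_(i <- r | P i) F i) = \sum_(i <- r | P i) I (F i).
Proof. by apply: (big_morph _ (cell_intD h_gt0 0) cell_int0). Qed.

Lemma cell_int_parts p q :
  I (p^`() * q) = p.[xr] * q.[xr] - p.[xl] * q.[xl] - I (p * q^`()).
Proof.
apply/eqP; rewrite eq_sym subr_eq eq_sym -cell_intD//.
by rewrite -derivM cell_int_deriv// !hornerM.
Qed.

Lemma cell_int_cst c : I c%:P = c * h%:C.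
Proof.
have -> : c%:P = (c *: 'X)^`() by rewrite derivZ derivX alg_polyC.
rewrite cell_int_deriv// !hornerE -mulrBr -rmorphB.
by congr (_ * _%:C); rewrite /interface; field.
Qed.

(** [D] is the Riesz representer, in polynomials of degree at most [k], of
    evaluation at the left end of the cell. *)
Definition left_trace_dual D : Prop := (size D <= k.+1)%N /\
  forall V, (size V <= k.+1)%N -> I (D * V) = V.[xl].

(** The Gram matrix of the monomials is invertible because the pairing is
    definite. *)
Lemma left_trace_dual_exists : exists D, left_trace_dual D.
Proof.
pose G : 'M[C]_k.+1 := \matrix_(i, j) I ('X^i * 'X^j).
have rV_I (c : 'rV[C]_k.+1) j : I (rVpoly c * 'X^j) = \sum_i c 0 i * I ('X^i * 'X^j).
  rewrite /rVpoly poly_def mulr_suml cell_int_sum; apply: eq_bigr => i _.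
  by rewrite -scalerAl cell_intZ//; case: insubP => [u _ /val_inj-> //|]; rewrite ltn_ord.
have rV_V (c : 'rV[C]_k.+1) V : (size V <= k.+1)%N ->
    I (rVpoly c * V) = \sum_(j < k.+1) (c *m G) 0 j * V`_j.
  move=> sV; rewrite -{1}(poly_rV_K sV) {2}/rVpoly poly_def mulr_sumr cell_int_sum.
  apply: eq_bigr => j _; rewrite -scalerAr cell_intZ// rV_I mulrC mxE.
  case: insubP => [u _ /val_inj->|]; last by rewrite ltn_ord.
  by rewrite mxE; congr (_ * _); apply: eq_bigr => i _; rewrite mxE.
have Gu : G \in unitmx.
  rewrite -row_free_unit; apply: inj_row_free => c cG.
  apply: (can_inj (@rVpolyK _ _)); rewrite linear0; apply: pairing_nondeg.
    exact: size_poly.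
  by move=> V sV; rewrite rV_V// cG big1// => j _; rewrite mxE mul0r.
exists (rVpoly ((\row_j xl ^+ j) *m invmx G)); split; first exact: size_poly.
move=> V sV; rewrite rV_V// mulmxKV// (horner_coef_wide _ sV).
by apply: eq_bigr => j _; rewrite mxE mulrC.
Qed.

End BlochAlgebra.

(** * The Bloch eigenvalue system *)

Section BlochSystem.
Context {R : realType} (k : nat) (h : R).
Hypothesis h_gt0 : 0 < h.
Local Open Scope complex_scope.
Local Notation C := R[i].
Local Notation I := (cell_int h 0).
Local Notation xr := ((interface h 0)%:C).
Local Notation xl := ((interface h (0 - 1))%:C).
Local Notation cj := (map_poly conjc).
Implicit Types (p q U Q V : {poly C}) (z c : C) (sg : R).

(** [U] and [Q] are the restrictions to [I_0] of a Bloch wave [u_h] (multiplied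
    by [z] from one cell to the next) and of its auxiliary variable, both tested
    after one integration by parts.  The equation [bloch_eig] says that the
    symbol maps [u_h] to [sg] times the mass matrix applied to it. *)
Record bloch z sg U Q : Prop := Bloch {
  bloch_sizeU : (size U <= k.+1)%N ;
  bloch_sizeQ : (size Q <= k.+1)%N ;
  bloch_aux : forall V, (size V <= k.+1)%N ->
    I (Q * V) = I (U^`() * V) + (U.[xl] - conjc z * U.[xr]) * V.[xl] ;
  bloch_eig : forall V, (size V <= k.+1)%N ->
    sg%:C * I (U * V) = - I (Q^`() * V) + (Q.[xr] - z * Q.[xl]) * V.[xr] }.

Lemma cjM p q : cj (p * q) = cj p * cj q. Proof. exact: rmorphM. Qed.
Lemma conjcM (x y : C) : conjc (x * y) = conjc x * conjc y.
Proof. exact: rmorphM. Qed.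
Lemma conjcD (x y : C) : conjc (x + y) = conjc x + conjc y.
Proof. exact: rmorphD. Qed.
Lemma conjcN (x : C) : conjc (- x) = - conjc x. Proof. exact: rmorphN. Qed.
Lemma conjcR (x : R) : conjc x%:C = x%:C :> C. Proof. exact: conjc_real. Qed.
Definition conjcE := (conjcM, conjcD, conjcN, conjcK, conjcR).

Lemma bloch_lin z sg U1 Q1 U2 Q2 (a b : C) :
  bloch z sg U1 Q1 -> bloch z sg U2 Q2 ->
  bloch z sg (a *: U1 + b *: U2) (a *: Q1 + b *: Q2).
Proof.
have sz (p q : {poly C}) : (size p <= k.+1)%N -> (size q <= k.+1)%N ->
    (size (a *: p + b *: q)%R <= k.+1)%N.
  move=> sp sq; apply: leq_trans (size_polyD _ _) _.
  by rewrite geq_max !(leq_trans (size_scale_leq _ _)).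
move=> [sU1 sQ1 a1 e1] [sU2 sQ2 a2 e2]; split; try exact: sz.
- move=> V sV; rewrite derivD !derivZ !mulrDl -!scalerAl !cell_intD// !cell_intZ//.
  by rewrite a1// a2// !(hornerD, hornerZ); ring.
- move=> V sV; rewrite derivD !derivZ !mulrDl -!scalerAl !cell_intD// !cell_intZ//.
  by rewrite mulrDr !(mulrCA sg%:C) e1// e2// !(hornerD, hornerZ); ring.
Qed.

(** Complex conjugation reverses the direction of the wave. *)
Lemma bloch_conj z sg U Q : bloch z sg U Q -> bloch (conjc z) sg (cj U) (cj Q).
Proof.
move=> [sU sQ a e]; split; rewrite ?size_cj// => V sV.
- have scV : (size (cj V) <= k.+1)%N by rewrite size_cj.
  rewrite -(cjK V) -cjM deriv_map -cjM !cell_int_conj// a//.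
  by rewrite !horner_cj !conjcE.
- have scV : (size (cj V) <= k.+1)%N by rewrite size_cj.
  rewrite -(cjK V) -cjM deriv_map -cjM !cell_int_conj//.
  by rewrite -[sg%:C]conjcR -conjcM e// !horner_cj !conjcE.
Qed.

Lemma cell_int_cj_deriv Q :
  I (Q^`() * cj Q) + conjc (I (Q^`() * cj Q)) =
  Q.[xr] * conjc Q.[xr] - Q.[xl] * conjc Q.[xl].
Proof.
rewrite {1}cell_int_parts// -cell_int_conj// cjM cjK -deriv_map.
by rewrite [(cj _)^`() * _]mulrC !horner_cj subrK.
Qed.

(** The alternating flux dissipates exactly the square of the jump [b]: the
    boundary terms left by the integration by parts complete the square because
    [|z| = 1]. *)
Lemma flux_identity z Q (b := Q.[xr] - z * Q.[xl]) : z * conjc z = 1 ->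
  let e := - I (Q^`() * cj Q) + b * (cj Q).[xr] in
  e + conjc e = b * conjc b.
Proof.
move=> z1 e; rewrite {}/e horner_cj !conjcE.
have -> : forall x y x' y' : C, - x + y + (- x' + y') = - (x + x') + (y + y').
  by move=> *; ring.
rewrite cell_int_cj_deriv /b ?conjcE.
(* The factor 1 is to become [z * conj z]. *)
transitivity (Q.[xr] * conjc Q.[xr] - z * Q.[xl] * conjc Q.[xr]
  - conjc z * conjc Q.[xl] * Q.[xr] + 1 * Q.[xl] * conjc Q.[xl]); first by ring.
by rewrite -z1; ring.
Qed.

(** The mirror image of [flux_identity], for the auxiliary equation. *)
Lemma flux_identity_aux z U (a := U.[xl] - conjc z * U.[xr]) : z * conjc z = 1 ->
  let e := I (U^`() * cj U) + a * (cj U).[xl] in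
  e + conjc e = a * conjc a.
Proof.
move=> z1 e; rewrite {}/e horner_cj !conjcE.
have -> : forall x y x' y' : C, x + y + (x' + y') = (x + x') + (y + y').
  by move=> *; ring.
rewrite cell_int_cj_deriv /a ?conjcE.
transitivity (U.[xl] * conjc U.[xl] - z * U.[xl] * conjc U.[xr]
  - conjc z * conjc U.[xl] * U.[xr] + 1 * U.[xr] * conjc U.[xr]); first by ring.
by rewrite -z1; ring.
Qed.

Lemma mul_conj_eq0 (c : C) : c * conjc c = 0 -> c = 0.
Proof. by move/eqP; rewrite mulf_eq0 conjc_eq0 orbb => /eqP. Qed.

(** Differentiation lowers the degree, so it has no nonzero eigenvalue. *)
Lemma deriv2_eigen_eq0 (c : C) U : c != 0 -> c *: U = - U^`()^`() -> U = 0.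
Proof.
move=> c0 e; apply/eqP/negPn/negP => U0.
have : size (c *: U) = size (- U^`()^`()) by rewrite e.
rewrite size_scale// size_polyN => s.
have := lt_size_deriv U0; have : (size U^`()^`() <= size U^`())%N.
  have [->|d0] := eqVneq U^`() 0; first by rewrite deriv0.
  by rewrite ltnW// lt_size_deriv.
by rewrite -s => ?; rewrite ltnNge => /negP.
Qed.

(** The jump [U(xl) - conj z U(xr)] is injective on each eigenspace of nonzero
    eigenvalue, which is therefore at most one-dimensional.  If the jump
    vanishes then [Q = U'], and [flux_identity] tested against [Q] forces the
    jump of [Q] to vanish too; what remains is [sg U = - U'']. *)
Lemma bloch_simple z sg U Q : z * conjc z = 1 -> sg != 0 -> bloch z sg U Q ->
  U.[xl] = conjc z * U.[xr] -> U = 0.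
Proof.
move=> z1 sg0 [sU sQ aux eig] a0.
have QU : Q = U^`().
  apply/eqP; rewrite -subr_eq0; apply/eqP; apply: (pairing_nondeg (k := k) (h := h)) => //.
    apply: leq_trans (size_polyD _ _) _; rewrite geq_max sQ size_polyN.
    exact: leq_trans (size_poly _ _) (leq_trans (leq_pred _) sU).
  by move=> V sV; rewrite mulrBl cell_intB// aux// a0 subrr mul0r addr0 subrr.
have b0 : Q.[xr] - z * Q.[xl] = 0.
  apply: mul_conj_eq0; rewrite -flux_identity//.
  rewrite -eig ?size_cj// conjcE ?conjcR -mulrDr.
  rewrite -cell_int_conj// cjM cjK QU mulrC -deriv_map [cj U * _]mulrC.
  rewrite [X in (_ + X) * _]cell_int_parts//.
  rewrite addrC subrK !horner_cj a0 conjcM conjcK.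
  transitivity ((1 - z * conjc z) * (U.[xr] * conjc U.[xr]) * sg%:C); first by ring.
  by rewrite z1 subrr !mul0r.
have : sg%:C *: U = - U^`()^`().
  apply/eqP; rewrite -subr_eq0 opprK; apply/eqP.
  apply: (pairing_nondeg (k := k) (h := h)) => // [|V sV].
    apply: leq_trans (size_polyD _ _) _; rewrite geq_max.
    rewrite (leq_trans (size_scale_leq _ _) sU) -QU.
    exact: leq_trans (size_poly _ _) (leq_trans (leq_pred _) sQ).
  by rewrite mulrDl -scalerAl cell_intD// cell_intZ// eig// b0 QU mul0r addr0 addNr.
by apply: deriv2_eigen_eq0; apply: contra_neq sg0 => /(congr1 (@complex.Re R)).
Qed.

(** Both equations tested with the constant 1. *)
Lemma bloch_mean z sg U Q : bloch z sg U Q ->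
  I Q = (1 - conjc z) * U.[xr] /\ sg%:C * I U = (1 - z) * Q.[xl].
Proof.
move=> [sU sQ aux eig].
have s1 : (size (1%R : {poly C}) <= k.+1)%N by rewrite size_poly1.
have := aux _ s1; have := eig _ s1.
rewrite !mulr1 !cell_int_deriv// !hornerC => -> ->; split; ring.
Qed.

(** The case [sg = 0] of the eigenvalue equation, which also governs the
    long-wave limit of [Q]: by [flux_identity] the jump vanishes, and then the
    pairing with [Q'] does. *)
Lemma closed_flux_deriv z Q : z * conjc z = 1 -> (size Q <= k.+1)%N ->
  (forall V, (size V <= k.+1)%N ->
    - I (Q^`() * V) + (Q.[xr] - z * Q.[xl]) * V.[xr] = 0) ->
  Q^`() = 0 /\ Q.[xr] = z * Q.[xl].
Proof.
move=> z1 sQ eig.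
have b0 : Q.[xr] - z * Q.[xl] = 0.
  apply: mul_conj_eq0; rewrite -flux_identity//.
  by rewrite eig ?size_cj// conjc0 addr0.
split; last by apply/eqP; rewrite -subr_eq0 b0.
apply: (pairing_nondeg (k := k) (h := h)) => // [|V sV].
  exact: leq_trans (size_poly _ _) (leq_trans (leq_pred _) sQ).
by have := eig V sV; rewrite b0 mul0r addr0 => /eqP; rewrite oppr_eq0 => /eqP.
Qed.

Lemma deriv0_cst Q : Q^`() = 0 -> Q = (Q`_0)%:P.
Proof.
move=> Q0; apply/polyP => -[|i]; rewrite coefC//=.
have := congr1 (fun q : {poly C} => q`_i) Q0; rewrite coef_deriv coef0.
by move=> /eqP; rewrite mulrn_eq0 => /eqP.
Qed.

(** The eigenvalue 0 carries only constants, with [c (1 - conj z) = 0].  First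
    [Q] is constant by [closed_flux_deriv] and vanishes by taking means; then
    the auxiliary equation is a homogeneous one for [U]. *)
Lemma bloch_zero z U Q : z * conjc z = 1 -> bloch z 0 U Q ->
  [/\ U^`() = 0, U.[xl] = conjc z * U.[xr] & Q = 0].
Proof.
move=> z1 B; have [iQ _] := bloch_mean B.
case: B => sU sQ aux eig.
have [Q'0 bQ] : Q^`() = 0 /\ Q.[xr] = z * Q.[xl].
  by apply: closed_flux_deriv => // V sV; rewrite -eig// mul0r.
have Q0 : Q = 0.
  have Qc := deriv0_cst Q'0; move: bQ iQ; rewrite Qc !hornerC cell_int_cst//.
  have [->|z_neq1] := eqVneq z 1.
    rewrite conjc1 subrr mul0r => _ /eqP; rewrite mulf_eq0.
    suff /negPf -> : h%:C != 0 :> C by rewrite orbF => /eqP ->.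
    by apply: contra_neq (lt0r_neq0 h_gt0) => /(congr1 (@complex.Re R)).
  move=> /eqP; rewrite -subr_eq0 -{1}[Q`_0]mul1r -mulrBl mulf_eq0 subr_eq0 eq_sym.
  by rewrite (negPf z_neq1) /= => /eqP ->.
have a0 : U.[xl] - conjc z * U.[xr] = 0.
  apply: mul_conj_eq0; rewrite -flux_identity_aux//.
  by rewrite -aux ?size_cj// Q0 mul0r cell_int0// conjc0 addr0.
split => //; last by apply/eqP; rewrite -subr_eq0 a0.
apply: (pairing_nondeg (k := k) (h := h)) => // [|V sV].
  exact: leq_trans (size_poly _ _) (leq_trans (leq_pred _) sU).
by have := aux V sV; rewrite a0 Q0 !mul0r addr0 cell_int0.
Qed.

(** The combination [a2 U1 - a1 U2] has no jump, so [bloch_simple] kills it. *)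
Lemma bloch_parallel z sg U1 Q1 U2 Q2 (a1 := U1.[xl] - conjc z * U1.[xr])
    (a2 := U2.[xl] - conjc z * U2.[xr]) :
  z * conjc z = 1 -> sg != 0 -> bloch z sg U1 Q1 -> bloch z sg U2 Q2 ->
  a2 *: U1 = a1 *: U2 /\ a2 *: Q1 = a1 *: Q2.
Proof.
move=> z1 sg0 B1 B2; have B := bloch_lin a2 (- a1) B1 B2.
have W0 : a2 *: U1 - a1 *: U2 = 0.
  rewrite -scaleNr; apply: (bloch_simple z1 sg0 B).
  by rewrite !(hornerD, hornerZ) /a1 /a2; ring.
split; first by apply/eqP; rewrite -subr_eq0 W0.
move: B; rewrite scaleNr W0 => -[_ sQ aux _].
apply/eqP; rewrite -subr_eq0 -scaleNr; apply/eqP.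
apply: (pairing_nondeg (k := k) (h := h)) => // V sV.
by rewrite aux// deriv0 mul0r !horner0 cell_int0// mulr0 subrr mul0r addr0.
Qed.

(** For real [z] the conjugate wave is again a solution with the same [z], hence
    proportional to the wave itself: up to a common complex factor, [U] and [Q]
    are real. *)
Lemma bloch_real_phase z sg U Q : z * conjc z = 1 -> conjc z = z -> sg != 0 ->
  bloch z sg U Q -> U != 0 -> conjc U.[xr] * Q.[xl] = conjc Q.[xl] * U.[xr].
Proof.
move=> z1 zr sg0 B U0; have Bc := bloch_conj B; rewrite zr in Bc.
have [eU eQ] := bloch_parallel z1 sg0 B Bc.
set a := U.[xl] - conjc z * U.[xr] in eU eQ.
have a0 : a != 0.
  apply: contra_neq U0 => a0; apply: (bloch_simple z1 sg0 B).
  by apply/eqP; rewrite -subr_eq0 -/a a0.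
have := congr1 (fun p : {poly C} => p.[xr]) eU.
have := congr1 (fun p : {poly C} => p.[xl]) eQ.
rewrite !hornerZ !horner_cj => e1 e2.
apply: (mulfI a0).
by rewrite mulrA -e2 [RHS]mulrA -e1 mulrAC.
Qed.

(** A finite-difference form of the Hellmann-Feynman formula, obtained by testing
    each of the two systems with the other solution; the bulk terms cancel and
    only the interface coupling, which carries [z], survives. *)
Lemma bloch_difference z0 z s0 s U0 Q0 U Q : bloch z0 s0 U0 Q0 -> bloch z s U Q ->
  (s - s0)%:C * I (U * cj U0) =
  - (z - z0) * conjc U0.[xr] * Q.[xl] - (conjc z - conjc z0) * U.[xr] * conjc Q0.[xl].
Proof.
move=> BL0 B; have := bloch_conj BL0.
case: BL0 => sU0 sQ0 _ _ [_ _ aux0 eig0]; case: B => sU sQ aux eig.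
have e1 := eig (cj U0); have e2 := aux0 Q sQ.
have e3 := eig0 U sU; have e4 := aux (cj Q0).
rewrite !size_cj in e1 e4; have {}e1 := e1 sU0; have {}e4 := e4 sQ0.
rewrite [(s - s0)%:C](_ : _ = s%:C - s0%:C); last by rewrite rmorphB.
rewrite mulrBl e1 {1}[U * cj U0]mulrC e3.
rewrite [I (Q^`() * _)]cell_int_parts// [Q * (cj U0)^`()]mulrC.
rewrite [I ((cj Q0)^`() * _)]cell_int_parts// [cj Q0 * U^`()]mulrC.
move: e2 e4; rewrite [Q * cj Q0]mulrC => -> /eqP.
rewrite eq_sym -subr_eq => /eqP <-.
rewrite !horner_cj conjcK; ring.
Qed.

(** For piecewise constants the two means of [bloch_mean] determine [sg]. *)
Lemma bloch_rank1 z sg U Q : k = 0%N -> bloch z sg U Q -> U != 0 ->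
  sg%:C * h%:C ^+ 2 = (1 - z) * (1 - conjc z).
Proof.
move=> k0 B U0; have [e1 e2] := bloch_mean B; case: B; rewrite k0 => sU sQ _ _.
move: e1 e2; rewrite (size1_polyC sU) (size1_polyC sQ) !hornerC !cell_int_cst//.
have : U`_0 != 0 by rewrite -polyC_eq0 -size1_polyC.
move: (U`_0) (Q`_0) => u q u0 e1 e2; apply: (mulIf u0).
transitivity (sg%:C * (u * h%:C) * h%:C); first by ring.
by rewrite e2 -mulrA e1; ring.
Qed.

End BlochSystem.

(** * From plane waves to the Bloch system *)

Section BlochReduction.
Context {R : realType} (k : nat) (h : R).
Hypothesis h_gt0 : 0 < h.
Local Open Scope complex_scope.
Local Notation C := R[i].
Local Notation I := (cell_int h 0).
Local Notation xr := ((interface h 0)%:C).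
Local Notation xl := ((interface h (0 - 1))%:C).
Local Notation cj := (map_poly conjc).
Implicit Types (p q U Q V : {poly C}) (z c : C) (sg : R) (w : 'cV[C]_k.+1).

Definition cell_poly w : {poly C} := \sum_(l < k.+1) w l 0 *: phiC h 0 l.

Lemma phiC0E l : phiC h 0 l = ((2 / h) ^+ l)%:C *: 'X^l.
Proof.
by rewrite /phiC /phi /node mul0r subr0 exprZn map_polyZ map_polyXn.
Qed.

Lemma phiC_shift j l : phiC h j l = phiC h 0 l \Po ('X - (node h j)%:C%:P).
Proof.
rewrite phiC0E /phiC /phi exprZn map_polyZ comp_polyZ comp_Xn_poly.
by rewrite (rmorphXn (map_poly (real_complex R)))
  (rmorphB (map_poly (real_complex R))) /= map_polyX map_polyC rmorphXn.
Qed.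

Lemma size_phiC l : (l < k.+1)%N -> (size (phiC h 0 l) <= k.+1)%N.
Proof.
move=> lk; rewrite phiC0E (leq_trans (size_scale_leq _ _))//.
by rewrite size_polyXn.
Qed.

Lemma size_cell_poly w : (size (cell_poly w) <= k.+1)%N.
Proof.
apply: (leq_trans (size_sum _ _ _)); apply/bigmax_leqP => l _.
rewrite (leq_trans (size_scale_leq _ _))//.
exact: size_phiC.
Qed.

Lemma cell_poly_onto V : (size V <= k.+1)%N -> exists w, V = cell_poly w.
Proof.
move=> sV; exists (\col_l (V`_l * ((h / 2) ^+ l)%:C)).
rewrite {1}[V](_ : _ = \sum_(l < k.+1) V`_l *: 'X^l); last first.
  apply/polyP => i; rewrite -poly_def coef_poly.
  by case: ltnP => // /(leq_trans sV) ?; rewrite nth_default.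
apply: eq_bigr => l _; rewrite mxE phiC0E scalerA -mulrA; congr (_ *: _).
rewrite -[in RHS]rmorphM -exprMn (_ : h / 2 * (2 / h) = 1) ?expr1n ?mulr1//.
by field; rewrite gt_eqF.
Qed.

Lemma expi_unit (t : R) : expi t * conjc (expi t) = 1.
Proof.
rewrite /expi /=; simpc; apply/eqP; rewrite eq_complex /=.
by rewrite -!expr2 cos2Dsin2 [sin t * _]mulrC addNr !eqxx.
Qed.

Lemma expiN (t : R) : expi (- t) = conjc (expi t).
Proof. by rewrite /expi cosN sinN. Qed.

Lemma horner_shift p j (x : R) :
  (p \Po ('X - (node h j)%:C%:P)).[x%:C] = p.[(x - node h j)%:C].
Proof. by rewrite horner_comp !(hornerE, hornerXsubC) rmorphB. Qed.

Lemma interface_node j : interface h j - node h j = interface h 0.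
Proof. by rewrite /interface /node; ring. Qed.

Lemma interface_node1 j : interface h (j - 1) - node h j = interface h (0 - 1).
Proof. by rewrite /interface /node !intrD; ring. Qed.

Section Wave.
Variables (z : C) (w : 'cV[C]_k.+1) (Q : {poly C}).
Hypothesis z1 : z * conjc z = 1.
Hypothesis sQ : (size Q <= k.+1)%N.
Hypothesis aux : forall V, (size V <= k.+1)%N ->
    I (Q * V) = I ((cell_poly w)^`() * V) +
      ((cell_poly w).[xl] - conjc z * (cell_poly w).[xr]) * V.[xl].

Definition wave_coef (j : int) : 'cV[C]_k.+1 := z ^ j *: w.
Definition wave_aux (j : int) : {poly C} :=
  z ^ j *: (Q \Po ('X - (node h j)%:C%:P)).

Lemma wave_fun j : dg_function h wave_coef j =
  z ^ j *: (cell_poly w \Po ('X - (node h j)%:C%:P)).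
Proof.
rewrite /dg_function /cell_poly raddf_sum /= scaler_sumr; apply: eq_bigr => l _.
by rewrite mxE linearZ /= -phiC_shift scalerA.
Qed.

Lemma z_neq0 : z != 0.
Proof. by apply: contra_eq_neq z1 => ->; rewrite mul0r eq_sym oner_eq0. Qed.

Lemma z_inv : z^-1 = conjc z.
Proof. by apply: (mulfI z_neq0); rewrite mulfV ?z_neq0. Qed.

Lemma wave_trace_plus_prev :
  trace_plus h wave_aux (0 - 1) = Q.[xl].
Proof. by rewrite /trace_plus /wave_aux subrK expr0z scale1r horner_shift interface_node1. Qed.

Lemma wave_trace_plus :
  trace_plus h wave_aux 0 = z * Q.[xl].
Proof.
rewrite /trace_plus /wave_aux add0r expr1z hornerZ horner_shift.
by rewrite -(interface_node1 1) subrr.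
Qed.

(** Cell by cell, translation to [I_0] turns the definition of the auxiliary
    variable into the hypothesis [aux]; the interface value coming from the left
    neighbour contributes the factor [z^-1 = conj z]. *)
Lemma wave_auxiliary : is_auxiliary k h (dg_function h wave_coef) wave_aux.
Proof.
split=> [j|j v sv].
  rewrite (leq_trans (size_scale_leq _ _))// size_comp_poly2// size_XsubC//.
pose V := v \Po ('X + (node h j)%:C%:P).
have sV : (size V <= k.+1)%N by rewrite size_comp_poly2// size_XaddC.
have vE : v = V \Po ('X - (node h j)%:C%:P).
  by rewrite /V -comp_polyA comp_polyD comp_polyX comp_polyC subrK comp_polyXr.
have dvE : v^`() = V^`() \Po ('X - (node h j)%:C%:P).
  by rewrite {1}vE deriv_comp derivB derivX derivC subr0 mulr1.
rewrite /trace_minus !wave_fun /wave_aux dvE vE -!scalerAl -!comp_polyM.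
rewrite !cell_intZ// !cell_int_shift// !hornerZ !horner_shift.
rewrite !interface_node !interface_node1 aux// cell_int_parts//.
have -> : z ^ (j - 1) = z ^ j * conjc z by rewrite expfzDr ?z_neq0// -z_inv.
ring.
Qed.

(** The stiffness blocks are known only through their action on pairs
    [u_h], [q_h]; evaluating this action on a plane wave computes the symbol. *)
Lemma symbol_wave Km1 K0 Kp1 (t : R) (l : 'I_k.+1) :
  stiffness_blocks h Km1 K0 Kp1 -> z = expi (t * h) ->
  (symbol h Km1 K0 Kp1 t *m w) l 0 =
  - I (Q^`() * phiC h 0 l) + (Q.[xr] - z * Q.[xl]) * (phiC h 0 l).[xr].
Proof.
move=> HK zE; have := HK _ _ wave_auxiliary 0 l.
have -> : mxC Km1 *m wave_coef (0 - 1) + mxC K0 *m wave_coef 0 +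
    mxC Kp1 *m wave_coef (0 + 1) = symbol h Km1 K0 Kp1 t *m w.
  rewrite /wave_coef /symbol sub0r add0r expr0z expr1z scale1r exprN1 z_inv.
  rewrite expiN -zE -!scalemxAr !mulmxDl -!scalemxAl.
  by rewrite [LHS]addrAC addrC addrA; congr (_ + _); rewrite addrC.
move=> ->; rewrite wave_trace_plus wave_trace_plus_prev /wave_aux expr0z scale1r.
rewrite (_ : node h 0 = 0) ?subr0; last by rewrite /node mul0r.
by rewrite comp_polyXr [in RHS]cell_int_parts//; ring.
Qed.

End Wave.
End BlochReduction.

(** * The mass matrix and eigenvectors of the symbol *)

Section BlochModes.
Context {R : realType} (k : nat) (h : R).
Hypothesis h_gt0 : 0 < h.
Local Open Scope complex_scope.
Local Notation C := R[i].
Local Notation I := (cell_int h 0).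
Local Notation xr := ((interface h 0)%:C).
Local Notation xl := ((interface h (0 - 1))%:C).
Local Notation cj := (map_poly conjc).
Implicit Types (p q U Q V : {poly C}) (z c : C) (sg : R) (w : 'cV[C]_k.+1).

Lemma cell_int_real (p : {poly R}) :
  I (map_poly (real_complex R) p) =
  (\int[@lebesgue_measure R]_(x in cell h 0) p.[x])%:C.
Proof.
rewrite /cell_int.
under [X in X +i* _]eq_Rintegral do rewrite horner_map /=.
under [X in _ +i* X]eq_Rintegral do rewrite horner_map /=.
by rewrite /= /Rintegral integral0.
Qed.

Lemma mass_mxE l m : mxC (mass_mx k h) l m = I (phiC h 0 l * phiC h 0 m).
Proof.
rewrite !mxE /phiC -rmorphM cell_int_real; congr (_%:C).
by apply: eq_Rintegral => x _; rewrite hornerM.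
Qed.

Lemma pairing_mass w (w' : 'cV[C]_k.+1) :
  I (cell_poly h w * cell_poly h w') = (w^T *m mxC (mass_mx k h) *m w') 0 0.
Proof.
rewrite mxE /cell_poly mulr_sumr cell_int_sum//; apply: eq_bigr => m _.
rewrite -scalerAr cell_intZ// mulrC; congr (_ * _).
rewrite mulr_suml cell_int_sum// mxE; apply: eq_bigr => l _.
by rewrite -scalerAl cell_intZ// mass_mxE [in RHS]mxE.
Qed.

Lemma cell_poly_conj w : cj (cell_poly h w) = cell_poly h (map_mx conjc w).
Proof.
rewrite /cell_poly rmorph_sum /=; apply: eq_bigr => l _.
rewrite map_polyZ mxE; congr (_ *: _).
by apply/polyP => i; rewrite coef_map /= coef_map /= oppr0.
Qed.

(** The eigenvalue equation, known on the basis functions by [symbol_wave],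
    extends to all test polynomials by linearity. *)
Lemma bloch_of_eigen Km1 K0 Kp1 (t sg : R) w Q :
  stiffness_blocks h Km1 K0 Kp1 ->
  (symbol h Km1 K0 Kp1 t - sg%:C *: mxC (mass_mx k h)) *m w = 0 ->
  (size Q <= k.+1)%N ->
  (forall V, (size V <= k.+1)%N -> I (Q * V) = I ((cell_poly h w)^`() * V) +
    ((cell_poly h w).[xl] - conjc (expi (t * h)) * (cell_poly h w).[xr]) * V.[xl]) ->
  bloch k h (expi (t * h)) sg (cell_poly h w) Q.
Proof.
move=> HK ew sQ aux; split => //; first exact: size_cell_poly.
move=> V sV; have [c ->] := cell_poly_onto h_gt0 sV.
pose F p := sg%:C * I (cell_poly h w * p) -
  (- I (Q^`() * p) + (Q.[xr] - expi (t * h) * Q.[xl]) * p.[xr]).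
suff F0 : F (cell_poly h c) = 0 by apply/eqP; rewrite -subr_eq0; apply/eqP.
have FD p q : F (p + q) = F p + F q.
  by rewrite /F !mulrDr !cell_intD// hornerD; ring.
have FZ a p : F (a *: p) = a * F p.
  by rewrite /F -!scalerAr !cell_intZ// hornerZ; ring.
rewrite /cell_poly (big_morph F FD (_ : F 0 = 0)); last first.
  by rewrite -(scale0r 0) FZ mul0r.
apply: big1 => l _; rewrite FZ (_ : F _ = 0) ?mulr0// /F.
have mw : I (cell_poly h w * phiC h 0 l) = (mxC (mass_mx k h) *m w) l 0.
  rewrite mxE /cell_poly mulr_suml cell_int_sum//; apply: eq_bigr => m _.
  by rewrite -scalerAl cell_intZ// mass_mxE mulrC [phiC h 0 l * _]mulrC.
rewrite mw -(symbol_wave h_gt0 (expi_unit _) sQ aux l HK erefl).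
move/matrixP/(_ l 0): ew; rewrite mulmxBl -scalemxAl !mxE => /eqP.
by rewrite subr_eq0 => /eqP ->; rewrite subrr.
Qed.

(** The auxiliary variable is explicit once the left trace is represented by
    [D]; in particular it depends on [U] through linear forms only. *)
Lemma auxiliary_formula D U (a : C) : left_trace_dual k h D -> (size U <= k.+1)%N ->
  (size (U^`() + a *: D)%R <= k.+1)%N /\
  forall V, (size V <= k.+1)%N ->
    I ((U^`() + a *: D) * V) = I (U^`() * V) + a * V.[xl].
Proof.
move=> [sD DV] sU; split=> [|V sV].
  apply: leq_trans (size_polyD _ _) _; rewrite geq_max.
  rewrite (leq_trans (size_scale_leq _ _) sD) andbT.
  exact: leq_trans (size_poly _ _) (leq_trans (leq_pred _) sU).
by rewrite mulrDl -scalerAl cell_intD// cell_intZ// DV.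
Qed.

End BlochModes.

(** * First-order expansion of real-analytic functions *)

Section AnalyticExpansion.
Context {R : realType}.
Implicit Types (A : set R) (f : R -> R).

(** The convergence of the series at one further point [y0] of [A] bounds its
    terms, hence dominates it by a geometric series on the half-size interval.
    This also covers the endpoints of an interval, where only one-sided
    information is available. *)
Lemma real_analytic_first_order A f x : real_analytic_on A f -> A x ->
  limit_point A x ->
  exists c K d, 0 < d /\ forall y, A y -> `|y - x| < d ->
    `|f y - f x - c * (y - x)| <= K * (y - x) ^+ 2.
Proof.
move=> fA Ax acc; have [a [r [r0 S]]] := fA x Ax.
have [y0 [y0x Ay0]] := acc _ (nbhsx_ballx x r r0); rewrite /ball /= distrC => ur.
have u0 : 0 < `|y0 - x| by rewrite normr_gt0 subr_eq0.
have [B aB] : exists B, forall n, `|a n * (y0 - x) ^+ n| <= B.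
  have := cvg_series_cvg_0 (cvgP _ (S y0 Ay0 ur)).
  move=> /cvgP/cvg_seq_bounded/pinfty_ex_gt0[B _ BP].
  by exists B => n; exact: BP.
pose u := `|y0 - x|.
have a_term n (t : R) : `|a n * t ^+ n| <= B * (`|t| / u) ^+ n.
  rewrite expr_div_n mulrA ler_pdivlMr ?exprn_gt0// normrM normrX mulrAC.
  by rewrite ler_wpM2r ?exprn_ge0// /u -normrX -normrM.
have M0 : 0 <= B by apply: le_trans (aB 0%N).
have part (t : R) N : `|t| / u <= 2^-1 ->
    `|series (fun n => a n * t ^+ n) N.+2 - a 0%N - a 1%N * t| <=
    B * (`|t| / u) ^+ 2 * (2 - 2 * 2^-1 ^+ N).
  move=> tu; elim: N => [|N IH].
    rewrite /series /= big_nat_recr//= big_nat1 expr0 expr1 mulr1.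
    rewrite (_ : forall p q : R, p + q - p - q = 0) ?normr0 ?expr0; last by move=> *; ring.
    by apply: mulr_ge0; [rewrite mulr_ge0 ?sqr_ge0|lra].
  rewrite /series /= big_nat_recr//= -/(series _ _).
  rewrite (_ : forall p q c d : R, p + q - c - d = (p - c - d) + q); last by move=> *; ring.
  apply: le_trans (ler_normD _ _) _; apply: le_trans (lerD IH (a_term _ _)) _.
  have -> : B * (`|t| / u) ^+ N.+2 = B * (`|t| / u) ^+ 2 * (`|t| / u) ^+ N.
    by rewrite -mulrA -exprD.
  have tN : (`|t| / u) ^+ N <= 2^-1 ^+ N.
    by apply: lerXn2r => //; rewrite nnegrE ?invr_ge0 ?ler0n// divr_ge0// ltW.
  have := ler_wpM2l (mulr_ge0 M0 (sqr_ge0 (`|t| / u))) tN.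
  rewrite [2^-1 ^+ N.+1]exprS; move: (B * (_ / _) ^+ 2) => M; lra.
have fx : f x = a 0%N.
  have /(_ Ax) := S x; rewrite subrr normr0 => /(_ r0).
  rewrite -cvg_shiftS => /cvg_lim <-//; apply/lim_near_cst => //.
  near=> n; rewrite /series /= big_nat_recl//= expr0 mulr1 big1 ?addr0// => i _.
  by rewrite expr0n mulr0.
(* On [|t| <= u / 2] the tail from order 2 is at most [B (t/u)^2 (1 + 1/2 + ..)]. *)
exists (a 1%N), (2 * B / u ^+ 2), (Num.min r (u / 2)); split.
  by rewrite lt_min r0 divr_gt0.
move=> y Ay; rewrite lt_min => /andP[yr yu]; rewrite fx.
have tu : `|y - x| / u <= 2^-1.
  by rewrite ler_pdivrMr// mulrC ltW.
have cv : `|series (fun n => a n * (y - x) ^+ n) N - a 0%N - a 1%N * (y - x)|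
    @[N --> \oo] --> `|f y - a 0%N - a 1%N * (y - x)|.
  by apply: cvg_norm; apply: cvgB (cvg_cst _); apply: cvgB (cvg_cst _); exact: S.
apply: cvgr_to_le cv _; exists 2%N => // -[//|[//|N _]] /=.
apply: le_trans (part _ N tu) _.
rewrite expr_div_n -normrX [`|(y - x) ^+ 2|]ger0_norm ?sqr_ge0//.
have : 0 <= 2^-1 ^+ N :> R by rewrite exprn_ge0.
have : 0 <= B * ((y - x) ^+ 2 / u ^+ 2) by rewrite mulr_ge0// divr_ge0 ?sqr_ge0.
rewrite (_ : 2 * B / u ^+ 2 * (y - x) ^+ 2 = 2 * (B * ((y - x) ^+ 2 / u ^+ 2))); last by ring.
move: (B * _) (2^-1 ^+ N) => M e; nra.
Unshelve. all: by end_near.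
Qed.

Lemma cvg_subid0 (F : set_system R) (x : R) : Filter F ->
  F --> x -> y - x @[y --> F] --> (0 : R).
Proof.
move=> FF Fx; rewrite -(subrr x).
have Fx' : y @[y --> F] --> x by [].
exact: (cvgB Fx' (cvg_cst x)).
Qed.

Lemma cvg_dist_le (F : set_system R) (f g : R -> R) (l : R) : Filter F ->
  g y @[y --> F] --> (0 : R) -> (\forall y \near F, `|f y - l| <= g y) ->
  f y @[y --> F] --> l.
Proof.
move=> FF g0 fg; apply/cvgrPdist_le => e e0.
have ge := cvgr0_norm_le _ g0 _ e0.
near=> y; rewrite distrC (le_trans (_ : _ <= g y))//; first by near: y.
by apply: le_trans (ler_norm _) _; near: y; exact: ge.
Unshelve. all: by end_near.
Qed.

Lemma real_analytic_cvg A f x (F : set_system R) : Filter F ->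
  real_analytic_on A f -> A x ->
  limit_point A x ->
  F --> x -> (\forall y \near F, A y) -> f y @[y --> F] --> f x.
Proof.
move=> FF fA Ax acc Fx FA.
have [c [K [d [d0 H]]]] := real_analytic_first_order fA Ax acc.
have lin : y - x @[y --> F] --> (0 : R).
  exact: cvg_subid0.
have b : `|c| * `|y - x| + K * ((y - x) * (y - x)) @[y --> F] --> (0 : R).
  have nlin : `|y - x| @[y --> F] --> (0 : R).
    by rewrite -(normr0 R); exact: cvg_norm.
  rewrite (_ : 0 = `|c| * 0 + K * (0 * 0)); last by ring.
  apply: cvgD; apply: cvgM => //; [exact: cvg_cst|exact: cvg_cst|exact: cvgM].
apply: cvg_dist_le b _.
have Fd : \forall y \near F, `|y - x| < d.
  exact: (cvgr0_norm_lt _ lin _ d0).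
near=> y.
have yA : A y by near: y.
have yd : `|y - x| < d by near: y.
rewrite -(subrK (c * (y - x)) (f y - f x)) (le_trans (ler_normD _ _))//.
by rewrite addrC -normrM lerD2l -expr2 H.
Unshelve. all: by end_near.
Qed.

Lemma real_analytic_slope A f x : real_analytic_on A f -> A x ->
  limit_point A x ->
  exists c : R, forall F : set_system R, Filter F -> F --> x ->
    (\forall y \near F, A y /\ y != x) ->
    (f y - f x) / (y - x) @[y --> F] --> c.
Proof.
move=> fA Ax acc.
have [c [K [d [d0 H]]]] := real_analytic_first_order fA Ax acc.
exists c => F FF Fx FA.
have lin : y - x @[y --> F] --> (0 : R).
  exact: cvg_subid0.
have b : K * `|y - x| @[y --> F] --> (0 : R).
  have nlin : `|y - x| @[y --> F] --> (0 : R).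
    by rewrite -(normr0 R); exact: cvg_norm.
  by rewrite -(mulr0 K); apply: cvgM => //; exact: cvg_cst.
have Fd : \forall y \near F, `|y - x| < d.
  exact: (cvgr0_norm_lt _ lin _ d0).
apply: cvg_dist_le b _.
near=> y.
have [yA yx] : A y /\ y != x by near: y.
have yd : `|y - x| < d by near: y.
have yx0 : 0 < `|y - x| by rewrite normr_gt0 subr_eq0.
have yx0' : y - x != 0 by rewrite subr_eq0.
rewrite -(ler_pM2r yx0); have := H y yA yd.
rewrite (_ : _ - _ - _ = ((f y - f x) / (y - x) - c) * (y - x)); last by field.
by rewrite normrM -[(y - x) ^+ 2]ger0_norm ?sqr_ge0// normrX expr2 mulrA.
Unshelve. all: by end_near.
Qed.

End AnalyticExpansion.

(** * Limits of complex-valued functions *)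

Section ComplexLimits.
Context {R : realType}.
Local Open Scope complex_scope.
Local Notation C := R[i].
Implicit Types (F : set_system R) (f g : R -> C) (x : R).

(** Limits in [R[i]] are taken componentwise: in the end only real parts of
    complex limits matter. *)
Definition ccvg F f (l : C) : Prop :=
  complex.Re (f y) @[y --> F] --> complex.Re l /\
  complex.Im (f y) @[y --> F] --> complex.Im l.

Lemma ReM (a b : C) :
  complex.Re (a * b) = complex.Re a * complex.Re b - complex.Im a * complex.Im b.
Proof. by case: a => a1 a2; case: b. Qed.

Lemma ImM (a b : C) :
  complex.Im (a * b) = complex.Re a * complex.Im b + complex.Im a * complex.Re b.
Proof. by case: a => a1 a2; case: b. Qed.

Lemma ReJ (a : C) : complex.Re (conjc a) = complex.Re a.
Proof. by case: a. Qed.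

Lemma ImJ (a : C) : complex.Im (conjc a) = - complex.Im a.
Proof. by case: a. Qed.

Section Ccvg.
Context {F : set_system R} {FF : Filter F}.

Lemma ccvg_cst (c : C) : ccvg F (fun=> c) c.
Proof. by split; exact: cvg_cst. Qed.

Lemma ccvgD f g a b : ccvg F f a -> ccvg F g b ->
  ccvg F (fun y => f y + g y) (a + b).
Proof.
move=> [f1 f2] [g1 g2]; split; rewrite raddfD.
  by under eq_cvg do rewrite raddfD; exact: cvgD.
by under eq_cvg do rewrite raddfD; exact: cvgD.
Qed.

Lemma ccvgN f a : ccvg F f a -> ccvg F (fun y => - f y) (- a).
Proof.
move=> [f1 f2]; split; rewrite raddfN.
  by under eq_cvg do rewrite raddfN; exact: cvgN.
by under eq_cvg do rewrite raddfN; exact: cvgN.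
Qed.

Lemma ccvgB f g a b : ccvg F f a -> ccvg F g b ->
  ccvg F (fun y => f y - g y) (a - b).
Proof. by move=> fa gb; apply: ccvgD => //; exact: ccvgN. Qed.

Lemma ccvgM f g a b : ccvg F f a -> ccvg F g b ->
  ccvg F (fun y => f y * g y) (a * b).
Proof.
move=> [f1 f2] [g1 g2]; split; rewrite (ReM, ImM).
  by under eq_cvg do rewrite ReM; apply: cvgB; exact: cvgM.
by under eq_cvg do rewrite ImM; apply: cvgD; exact: cvgM.
Qed.

Lemma ccvg_conj f a : ccvg F f a -> ccvg F (fun y => conjc (f y)) (conjc a).
Proof.
move=> [f1 f2]; split; rewrite (ReJ, ImJ).
  by under eq_cvg do rewrite ReJ.
by under eq_cvg do rewrite ImJ; exact: cvgN.
Qed.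

Lemma ccvg_sum (T : Type) (r : seq T) (f : T -> R -> C) (a : T -> C) :
  (forall i, ccvg F (f i) (a i)) ->
  ccvg F (fun y => \sum_(i <- r) f i y) (\sum_(i <- r) a i).
Proof.
move=> fa; elim: r => [|i r IH].
  by rewrite big_nil; under eq_fun do rewrite big_nil; exact: ccvg_cst.
rewrite big_cons; under eq_fun do rewrite big_cons.
exact: ccvgD.
Qed.

Lemma ccvg_real (f : R -> R) (a : R) : f y @[y --> F] --> a ->
  ccvg F (fun y => (f y)%:C) a%:C.
Proof. by move=> fa; split => //; exact: cvg_cst. Qed.

Lemma ccvg_near f g a : (\forall y \near F, f y = g y) -> ccvg F f a -> ccvg F g a.
Proof.
move=> fg [f1 f2]; split.
  by move: f1; apply: cvg_trans; apply: near_eq_cvg; near=> y; congr complex.Re; near: y.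
by move: f2; apply: cvg_trans; apply: near_eq_cvg; near=> y; congr complex.Im; near: y.
Unshelve. all: by end_near.
Qed.

(** The quotient [f] is real, so the real parts of [E] and [G] determine it. *)
Lemma ccvg_quotient (f : R -> R) (G E : R -> C) (g e : C) :
  (\forall y \near F, (f y)%:C * G y = E y) -> ccvg F G g -> ccvg F E e ->
  complex.Re g != 0 -> f y @[y --> F] --> complex.Re e / complex.Re g.
Proof.
move=> fE [G1 _] [E1 _] g0.
have : complex.Re (E y) / complex.Re (G y) @[y --> F] --> complex.Re e / complex.Re g.
  by apply: cvgM => //; exact: cvgV.
apply: cvg_trans; apply: near_eq_cvg.
have Gn : \forall y \near F, complex.Re (G y) != 0.
  exact: (cvgr_neq0 _ G1).
near=> y; have <- : (f y)%:C * G y = E y by near: y.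
by rewrite ReM mul0r subr0 mulfK//; near: y.
Unshelve. all: by end_near.
Qed.

End Ccvg.

Lemma ccvg_unique F f a b : ProperFilter F -> ccvg F f a -> ccvg F f b -> a = b.
Proof.
move=> FF [f1 f2] [g1 g2]; apply/eqP; rewrite eq_complex.
by rewrite (cvg_unique _ f1 g1) // (cvg_unique _ f2 g2) // !eqxx.
Qed.

Lemma is_derive_mulr (c x : R) : is_derive x 1 (fun y => y * c) c.
Proof. by apply: is_derive_eq; rewrite [_ *: 1]mulr1 ?scaler0 ?add0r. Qed.

Lemma cvg_addr_dnbhs (x a : R) : h + a @[h --> x^'] --> (x + a)^'.
Proof.
move=> U xU; have c : h + a @[h --> x] --> x + a.
  by apply: cvgD; [exact: cvg_id|exact: cvg_cst].
have cU : nbhs x [set h | h + a != x + a -> U (h + a)] := c _ xU.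
suff : nbhs x [set h | h != x -> U (h + a)] by [].
apply: filterS cU => h /= Uh hx.
by apply: Uh; apply: contra_neq hx => /addIr.
Qed.

Lemma is_derive_slope (f : R -> R) (x df : R) (F : set_system R) : Filter F ->
  F --> x -> (\forall y \near F, y != x) -> is_derive x 1 f df ->
  (f y - f x) / (y - x) @[y --> F] --> df.
Proof.
move=> FF Fx Fn dfx.
have Fx' : F --> x^'.
  move=> U /Fx; rewrite /nbhs /= => xU; near=> y.
  have yx : y != x by near: y.
  by move: yx; near: y.
have : h^-1 *: ((f \o shift x) (h *: 1) - f x) @[h --> 0^'] --> df.
  by case: dfx => dfx <-; exact: dfx.
have sh := cvg_addr_dnbhs (x := x) (a := - x); rewrite subrr in sh.
move=> /(cvg_comp _ _ (cvg_trans (cvg_app _ Fx') sh)).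
by apply: cvg_trans; apply: near_eq_cvg; near=> y; rewrite /= [_ *: 1]mulr1 subrK mulrC.
Unshelve. all: by end_near.
Qed.

Lemma slope_is_derive (f : R -> R) (x df : R) :
  (f y - f x) / (y - x) @[y --> x^'] --> df -> is_derive x 1 f df.
Proof.
move=> sl.
have c : h^-1 *: ((f \o shift x) (h *: 1) - f x) @[h --> 0^'] --> df.
  have sh := cvg_addr_dnbhs (x := 0) (a := x); rewrite add0r in sh.
  move: (cvg_comp _ _ sh sl); apply: cvg_trans; apply: near_eq_cvg; near=> h.
  by rewrite /= [_ *: 1]mulr1 addrK mulrC.
by apply: DeriveDef; [apply: cvgP c|exact: cvg_lim c].
Unshelve. all: by end_near.
Qed.

End ComplexLimits.

(** * Dispersion branches *)

Section Modes.
Context {R : realType} (k : nat) (h : R) (Km1 K0 Kp1 : 'M[R]_k.+1)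
  (sigma : mode k -> R -> R) (v : mode k -> R -> 'cV[R[i]]_k.+1).
Hypothesis h_gt0 : 0 < h.
Hypothesis HK : stiffness_blocks h Km1 K0 Kp1.
Hypothesis Hm : eigenbranches h Km1 K0 Kp1 sigma v.
Local Open Scope complex_scope.
Local Notation C := R[i].
Local Notation I := (cell_int h 0).
Local Notation xr := ((interface h 0)%:C).
Local Notation xl := ((interface h (0 - 1))%:C).
Local Notation cj := (map_poly conjc).
Local Notation B := (Brillouin h).
Local Notation T := (pi / h).
Implicit Types (p q V : {poly C}) (x y t : R) (m n : mode k) (F : set_system R).

Variable D : {poly C}.
Hypothesis HD : left_trace_dual k h D.

Definition phase x : C := expi (x * h).
Definition modeU m x : {poly C} := cell_poly h (v m x).
(** The jump of the mode at the left end of the cell. *)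
Definition modeA m x : C := (modeU m x).[xl] - conjc (phase x) * (modeU m x).[xr].
(** The auxiliary variable of the mode, see [auxiliary_formula]. *)
Definition modeQ m x : {poly C} := (modeU m x)^`() + modeA m x *: D.

Lemma T_gt0 : 0 < T. Proof. by rewrite divr_gt0// pi_gt0. Qed.

Lemma BrillouinP x : B x <-> - T <= x <= T.
Proof. by rewrite /Brillouin /= in_itv. Qed.

Lemma Brillouin_limit_point x : B x -> limit_point B x.
Proof.
move=> /BrillouinP/andP[xT Tx] W /nbhs_ballP[e /= e0 eW]; have T0 := T_gt0.
pose d := Num.min (e / 2) T.
have d0 : 0 < d by rewrite lt_min T0 divr_gt0.
have dT : d <= T by rewrite ge_min lexx orbT.
have de : d < e by rewrite gt_min; apply/orP; left; lra.
have [x0|x0] := leP 0 x.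
  (* A step towards the origin of length at most pi / h stays in the zone. *)
  exists (x - d); split.
  - by rewrite lt_eqF// gtrBl.
  - by apply/BrillouinP; apply/andP; split; lra.
  - by apply: eW; rewrite /ball /= opprB addrC subrK gtr0_norm.
exists (x + d); split.
- by rewrite gt_eqF// ltrDl.
- by apply/BrillouinP; apply/andP; split; lra.
- by apply: eW; rewrite /ball /= opprD addNKr normrN gtr0_norm.
Qed.

Lemma mode_bloch m x : B x -> bloch k h (phase x) (sigma m x) (modeU m x) (modeQ m x).
Proof.
move=> Bx; have sU := size_cell_poly h (v m x).
have [sQ aux] := auxiliary_formula h_gt0 (modeA m x) HD sU.
exact: (bloch_of_eigen h_gt0 HK (eigen_eq Hm m Bx) sQ aux).
Qed.

Lemma mode_orthonormal m n x : B x ->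
  I (modeU n x * cj (modeU m x)) = if m == n :> option 'I_k then 1 else 0.
Proof.
move=> Bx; rewrite mulrC /modeU cell_poly_conj pairing_mass// map_trmx.
by rewrite -map_trmx (v_orthonormal Hm m n Bx) !mxE mulr1n.
Qed.

Lemma modeU_neq0 m x : B x -> modeU m x != 0.
Proof.
move=> Bx; apply/eqP => U0; have := mode_orthonormal m m Bx.
by rewrite U0 mul0r cell_int0// eqxx => /eqP; rewrite eq_sym oner_eq0.
Qed.

Lemma phase_unit x : phase x * conjc (phase x) = 1.
Proof. exact: expi_unit. Qed.

Lemma Brillouin0 : B 0.
Proof. by apply/BrillouinP; have := T_gt0; move=> ?; apply/andP; split; lra. Qed.

Lemma phase0 : phase 0 = 1.
Proof. by rewrite /phase /expi mul0r cos0 sin0. Qed.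

Lemma phaseT : phase T = -1.
Proof.
rewrite /phase /expi divfK ?gt_eqF// cospi sinpi.
by apply/eqP; rewrite eq_complex /= oppr0 !eqxx.
Qed.

Lemma phaseNT : phase (- T) = -1.
Proof. by rewrite /phase mulNr expiN -/(phase T) phaseT rmorphN1. Qed.

Lemma phase_eq1 x : B x -> phase x = 1 -> x = 0.
Proof.
move=> /BrillouinP/andP[xT Tx] [c1 _].
have hx : `|x * h| = 0.
  apply: (@cos_inj R); rewrite ?in_itv/= ?lexx ?pi_ge0 ?normr_ge0//=.
    by rewrite normrM (gtr0_norm h_gt0) -ler_pdivlMr// ler_norml xT.
  have cosn (t : R) : cos `|t| = cos t by case: (ger0P t) => // _; rewrite cosN.
  by rewrite cosn cos0.
by move/eqP: hx; rewrite normr_eq0 mulf_eq0 (gt_eqF h_gt0) orbF => /eqP.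
Qed.

(** A zero eigenvalue would force a constant mode with [phase x = 1]. *)
Lemma sigma_gt0 m x : B x -> x != 0 -> 0 < sigma m x.
Proof.
move=> Bx x0; rewrite lt_neqAle (sigma_ge0 Hm m Bx) andbT eq_sym.
apply/eqP => s0; have Bl := mode_bloch m Bx; rewrite s0 in Bl.
have [U'0 a0 _] := bloch_zero h_gt0 (phase_unit x) Bl.
have U0 := modeU_neq0 m Bx; move: U'0 a0 U0 => /(@deriv0_cst R) ->.
rewrite !hornerC polyC_eq0 => /eqP; rewrite -subr_eq0 -{1}[_`_0]mul1r -mulrBl.
rewrite mulf_eq0 => /orP[|/eqP -> /eqP//]; rewrite subr_eq0 => /eqP z1 _.
move/eqP: x0; apply; apply: phase_eq1 => //.
by rewrite -[phase x]conjcK -z1 conjc1.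
Qed.

(** Distinct branches never meet at a positive value: two orthonormal
    eigenvectors cannot be proportional. *)
Lemma sigma_inj m n x : B x -> sigma m x = sigma n x -> 0 < sigma m x -> m = n.
Proof.
move=> Bx smn sm; apply/eqP/negPn/negP => mn.
have Bm := mode_bloch m Bx; have Bn := mode_bloch n Bx; rewrite -smn in Bn.
have s0 : sigma m x != 0 by rewrite gt_eqF.
have [eU _] := bloch_parallel h_gt0 (phase_unit x) s0 Bm Bn.
rewrite -!/(modeA _ x) in eU.
have a0 l : modeA l x = 0 -> sigma l x != 0 -> False.
  move=> al sl; have := modeU_neq0 l Bx => /eqP; apply.
  apply: (bloch_simple h_gt0 (phase_unit x) sl (mode_bloch l Bx)).
  by apply/eqP; rewrite -subr_eq0 -/(modeA l x) al.
have := congr1 (fun p : {poly C} => I (p * cj (modeU m x))) eU.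
rewrite -!scalerAl !cell_intZ// !mode_orthonormal// eqxx (negPf mn) mulr0 mulr1.
by move=> an; apply: (a0 n) => //; rewrite -smn.
Qed.

(** Limits of polynomials of bounded degree are taken through linear forms. *)
Definition lin_form (L : {poly C} -> C) := forall a p q, L (a *: p + q) = a * L p + L q.

Lemma lin_form0 L : lin_form L -> L 0 = 0.
Proof. by move=> Ll; have := Ll (-1) 0 0; rewrite scaler0 add0r mulN1r addNr. Qed.

Lemma lin_form_horner (a : C) : lin_form (fun p => p.[a]).
Proof. by move=> c p q; rewrite hornerD hornerZ. Qed.

Lemma lin_form_int q0 : lin_form (fun p => I (p * q0)).
Proof. by move=> c p q; rewrite mulrDl -scalerAl cell_intD// cell_intZ. Qed.

Lemma lin_form_deriv L : lin_form L -> lin_form (fun p => L p^`()).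
Proof. by move=> Ll c p q; rewrite derivD derivZ Ll. Qed.

Lemma phase_cvg F x : Filter F -> F --> x -> ccvg F phase (phase x).
Proof.
move=> FF Fx; have Fxh : y * h @[y --> F] --> x * h.
  by apply: cvgM; [exact: Fx|exact: cvg_cst].
split; rewrite /phase /expi /=.
  by apply: continuous_cvg Fxh; exact: continuous_cos.
by apply: continuous_cvg Fxh; exact: continuous_sin.
Qed.

Definition dphase x : C := 'i * h%:C * phase x.

Lemma phase_slope F x : Filter F -> F --> x -> (\forall y \near F, y != x) ->
  ccvg F (fun y => (phase y - phase x) * ((y - x)^-1)%:C) (dphase x).
Proof.
move=> FF Fx Fn.
have dh := is_derive_mulr h x.
have dc := @is_derive1_comp R cos (fun y : R => y * h) x _ _ (is_derive_cos _) dh.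
have ds := @is_derive1_comp R sin (fun y : R => y * h) x _ _ (is_derive_sin _) dh.
split.
  have -> : complex.Re (dphase x) = - sin (x * h) * h by rewrite /dphase /= ; ring.
  move: (is_derive_slope FF Fx Fn dc); apply: cvg_trans; apply: near_eq_cvg.
  by near=> y; rewrite ReM /= mulr0 subr0.
have -> : complex.Im (dphase x) = cos (x * h) * h by rewrite /dphase /= ; ring.
move: (is_derive_slope FF Fx Fn ds); apply: cvg_trans; apply: near_eq_cvg.
by near=> y; rewrite ImM /= mulr0 add0r.
Unshelve. all: by end_near.
Qed.

Section Cvg.
Context {F : set_system R} {FF : Filter F} (x : R).
Hypotheses (Fx : F --> x) (FB : \forall y \near F, B y) (Bx : B x).

Lemma sigma_cvg m : sigma m y @[y --> F] --> sigma m x.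
Proof.
exact: real_analytic_cvg (sigma_analytic Hm m) Bx (Brillouin_limit_point Bx) Fx FB.
Qed.

Lemma v_cvg m l : ccvg F (fun y => v m y l 0) (v m x l 0).
Proof.
have [aR aI] := v_analytic Hm m l.
split; [exact: real_analytic_cvg aR Bx (Brillouin_limit_point Bx) Fx FB|].
exact: real_analytic_cvg aI Bx (Brillouin_limit_point Bx) Fx FB.
Qed.

Lemma cell_poly_cvg (w : R -> 'cV[C]_k.+1) (w0 : 'cV[C]_k.+1) (L : {poly C} -> C) :
  (forall l, ccvg F (fun y => w y l 0) (w0 l 0)) ->
  lin_form L ->
  ccvg F (fun y => L (cell_poly h (w y))) (L (cell_poly h w0)).
Proof.
move=> ww0 Llin.
have L0 := lin_form0 Llin.
have LD p q : L (p + q) = L p + L q.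
  by have := Llin 1 p q; rewrite scale1r mul1r.
have LE w1 : L (cell_poly h w1) = \sum_(l < k.+1) w1 l 0 * L (phiC h 0 l).
  rewrite /cell_poly (big_morph L LD L0); apply: eq_bigr => l _.
  by have := Llin (w1 l 0) (phiC h 0 l) 0; rewrite L0 !addr0.
rewrite LE; under eq_fun do rewrite LE.
by apply: ccvg_sum => l; apply: ccvgM => //; exact: ccvg_cst.
Qed.

Lemma modeU_cvg m L : lin_form L -> ccvg F (fun y => L (modeU m y)) (L (modeU m x)).
Proof. by move=> Ll; apply: cell_poly_cvg => // l; exact: v_cvg. Qed.

Lemma modeA_cvg m : ccvg F (modeA m) (modeA m x).
Proof.
apply: ccvgB; first exact: modeU_cvg (lin_form_horner _).
apply: ccvgM; first by apply: ccvg_conj; exact: phase_cvg.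
exact: modeU_cvg (lin_form_horner _).
Qed.

Lemma modeQ_cvg m L : lin_form L -> ccvg F (fun y => L (modeQ m y)) (L (modeQ m x)).
Proof.
move=> Ll; rewrite /modeQ.
have LE y : L ((modeU m y)^`() + modeA m y *: D) = modeA m y * L D + L (modeU m y)^`().
  by rewrite addrC Ll.
rewrite LE; under eq_fun do rewrite LE.
apply: ccvgD; last exact: modeU_cvg (lin_form_deriv Ll).
by apply: ccvgM; [exact: modeA_cvg|exact: ccvg_cst].
Qed.

End Cvg.

(** The limit of the difference quotient given by [bloch_difference]; by
    [sigma_derive] its real part is the derivative of the branch. *)
Definition slopeC m x : C :=
  - dphase x * conjc (modeU m x).[xr] * (modeQ m x).[xl]
  - conjc (dphase x) * (modeU m x).[xr] * conjc (modeQ m x).[xl].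
Definition slope m x : R := complex.Re (slopeC m x).

Lemma slope_cvg F m x : Filter F -> F --> x -> (\forall y \near F, B y) -> B x ->
  slope m y @[y --> F] --> slope m x.
Proof.
move=> FF Fx FB Bx.
suff [] : ccvg F (slopeC m) (slopeC m x) by [].
have cz : ccvg F dphase (dphase x).
  by apply: ccvgM; [exact: ccvg_cst|exact: phase_cvg].
pose proof (modeU_cvg Fx FB Bx m (lin_form_horner xr)) as cU.
pose proof (modeQ_cvg Fx FB Bx m (lin_form_horner xl)) as cQ.
pose proof (ccvgM (ccvgM (ccvgN cz) (ccvg_conj cU)) cQ) as c1.
pose proof (ccvgM (ccvgM (ccvg_conj cz) cU) (ccvg_conj cQ)) as c2.
exact: (ccvgB c1 c2).
Qed.

Lemma near_interior x : - T < x < T -> \forall y \near x, B y.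
Proof.
move=> xT; have : x \in `](- T), T[ by rewrite in_itv.
move=> /near_in_itvoo; apply: filterS => y; rewrite in_itv /= => /andP[y1 y2].
by apply/BrillouinP; rewrite !ltW.
Qed.

(** Dividing [bloch_difference] by [y - x], the factor [I (U conj U0)] tends to
    the squared norm 1, and the derivative of the phase is the only
    derivative that enters. *)
Lemma sigma_derive m x : - T < x < T -> is_derive x 1 (sigma m) (slope m x).
Proof.
move=> xT; have Bx : B x.
  by apply/BrillouinP; case/andP: xT => ? ?; rewrite !ltW.
apply: slope_is_derive.
have Fx : x^' --> x by exact: nbhs_dnbhs.
have FB : \forall y \near x^', B y by apply: nbhs_dnbhs; exact: near_interior.
have Fn : \forall y \near x^', y != x by exact: nbhs_dnbhs_neq.
pose proof (modeU_cvg Fx FB Bx m (lin_form_int (cj (modeU m x)))) as J.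
rewrite /= mode_orthonormal// eqxx in J.
have sE : slope m x = slope m x / complex.Re 1 by rewrite /= divr1.
rewrite sE; apply: (ccvg_quotient (E := fun y =>
   (- ((phase y - phase x) * ((y - x)^-1)%:C) * conjc (modeU m x).[xr] * (modeQ m y).[xl]
    - conjc ((phase y - phase x) * ((y - x)^-1)%:C) * (modeU m y).[xr] * conjc (modeQ m x).[xl])) _ J).
- near=> y.
  have By : B y by near: y.
  rewrite rmorphM mulrAC.
  rewrite (bloch_difference h_gt0 (mode_bloch m Bx) (mode_bloch m By)).
  by rewrite !conjcE; ring.
- pose proof (phase_slope (dnbhs_filter x) Fx Fn) as cz.
  pose proof (modeU_cvg Fx FB Bx m (lin_form_horner xr)) as cU.
  pose proof (modeQ_cvg Fx FB Bx m (lin_form_horner xl)) as cQ.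
  pose proof (ccvgM (ccvgM (ccvgN cz) (ccvg_cst (conjc (modeU m x).[xr]))) cQ) as c1.
  pose proof (ccvgM (ccvgM (ccvg_conj cz) cU) (ccvg_cst (conjc (modeQ m x).[xl]))) as c2.
  exact: (ccvgB c1 c2).
- by rewrite oner_eq0.
Unshelve. all: by end_near.
Qed.

(** [dphase] is purely imaginary for a real phase, so the two terms of [slopeC]
    cancel by [bloch_real_phase]. *)
Lemma slope_real_phase m x : B x -> sigma m x != 0 ->
  conjc (phase x) = phase x -> slope m x = 0.
Proof.
move=> Bx s0 zr; rewrite /slope.
have e := bloch_real_phase h_gt0 (phase_unit x) zr s0 (mode_bloch m Bx) (modeU_neq0 m Bx).
suff -> : slopeC m x = 0 by [].
transitivity (- dphase x * (conjc (modeU m x).[xr] * (modeQ m x).[xl] -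
    conjc (modeQ m x).[xl] * (modeU m x).[xr])).
  have ci : conjc 'i = - 'i :> C by apply/eqP; rewrite eq_complex /= oppr0 !eqxx.
  by rewrite /slopeC /dphase !conjcE zr ci; ring.
by rewrite e subrr mulr0.
Qed.

Section LongWave.
Let m : mode k := ph k.
Let F : set_system R := 0^'.
Local Notation fr y := ((y^-1)%:C).

Let FF : Filter F. Proof. exact: dnbhs_filter. Qed.
Let FP : ProperFilter F. Proof. by rewrite /F; exact: _. Qed.
Let F0 : F --> 0. Proof. exact: nbhs_dnbhs. Qed.
Let Fn : \forall y \near F, y != 0. Proof. exact: nbhs_dnbhs_neq. Qed.
Let FB : \forall y \near F, B y.
Proof.
apply: nbhs_dnbhs; apply: near_interior.
by rewrite oppr_lt0 T_gt0.
Qed.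

(** At frequency 0 the physical eigenvalue is 0, so that [bloch_zero] applies;
    the normalization of the mode then fixes the modulus of its value [c]. *)
Lemma ph_rest : exists c, modeU m 0 = c%:P /\ modeQ m 0 = 0 /\ c * conjc c * h%:C = 1.
Proof.
have Bl := mode_bloch m Brillouin0; rewrite (sigma_ph0 Hm) in Bl.
have [U'0 _ Q0] := bloch_zero h_gt0 (phase_unit 0) Bl.
have Uc := deriv0_cst U'0; exists (modeU m 0)`_0; split=> //; split=> //.
have := mode_orthonormal m m Brillouin0; rewrite eqxx Uc map_polyC /= -polyCM.
by rewrite cell_int_cst// coefC.
Qed.

Lemma cell_polyB a (w w' : 'cV[C]_k.+1) :
  cell_poly h (a *: (w - w')) = a *: (cell_poly h w - cell_poly h w').
Proof.
rewrite /cell_poly -sumrB scaler_sumr; apply: eq_bigr => l _.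
by rewrite !mxE -scalerBl scalerA.
Qed.

(** Analyticity of the eigenvector gives the derivative [dU] of the mode at 0,
    as seen by every linear form. *)
Lemma modeU_slope : exists dU : {poly C}, (size dU <= k.+1)%N /\
  forall L, lin_form L ->
    ccvg F (fun y => (L (modeU m y) - L (modeU m 0)) * fr y) (L dU).
Proof.
have /choice[dv dvP] : forall l, exists d,
    ccvg F (fun y => (v m y l 0 - v m 0 l 0) * fr y) d.
  move=> l; have [aR aI] := v_analytic Hm m l.
  have FBn : \forall y \near F, B y /\ y != 0 by near=> y; split; near: y.
  have [c1 /(_ F FF F0 FBn) c1P] :=
    real_analytic_slope aR Brillouin0 (Brillouin_limit_point Brillouin0).
  have [c2 /(_ F FF F0 FBn) c2P] :=
    real_analytic_slope aI Brillouin0 (Brillouin_limit_point Brillouin0).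
  exists (c1 +i* c2); split.
    move: c1P; apply: cvg_trans; apply: near_eq_cvg; near=> y.
    by rewrite ReM /= mulr0 !subr0; case: (v m y l 0) => ? ?; case: (v m 0 l 0).
  move: c2P; apply: cvg_trans; apply: near_eq_cvg; near=> y.
  by rewrite ImM /= mulr0 add0r subr0; case: (v m y l 0) => ? ?; case: (v m 0 l 0).
exists (cell_poly h (\col_l dv l)); split; first exact: size_cell_poly.
move=> L Ll.
have LE y : (L (modeU m y) - L (modeU m 0)) * fr y =
    L (cell_poly h (fr y *: (v m y - v m 0))).
  have L0 := lin_form0 Ll.
  rewrite cell_polyB -[_ *: _]addr0 Ll L0 addr0 mulrC; congr (_ * _).
  by rewrite [_ - cell_poly _ _]addrC -[- cell_poly _ _]scaleN1r Ll mulN1r addrC.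
under eq_fun do rewrite LE.
apply: cell_poly_cvg => // l; rewrite mxE.
by apply: ccvg_near (dvP l); near=> y; rewrite !mxE mulrC.
Unshelve. all: by end_near.
Qed.

Lemma sigma_over_id : sigma m y / y @[y --> F] --> (0 : R).
Proof.
have [c [_ [Q0 _]]] := ph_rest.
have T0 : - T < 0 < T by rewrite oppr_lt0 T_gt0.
have := is_derive_slope FF F0 Fn (sigma_derive m T0).
rewrite /slope /slopeC Q0 horner0 conjc0 !mulr0 subr0 (sigma_ph0 Hm).
by under eq_cvg do rewrite !subr0.
Qed.

Lemma conjcI : conjc 'i = - 'i :> C.
Proof. by apply/eqP; rewrite eq_complex /= oppr0 !eqxx. Qed.

(** The limit [r0] of [Q / y] is constant: the eigenvalue equation divided by
    [y] has right-hand side [sigma / y -> 0], so [closed_flux_deriv] applies with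
    [z = 1].  Its value comes from the mean of the auxiliary equation,
    [I Q = (1 - conj z) U(xr)]. *)
Lemma modeQ_slope : exists c, modeU m 0 = c%:P /\ c * conjc c * h%:C = 1 /\
  ccvg F (fun y => (modeQ m y).[xl] * fr y) ('i * c).
Proof.
have [c [Uc [Q0 cn]]] := ph_rest; exists c; split=> //; split=> //.
have [dU [sdU dUP]] := modeU_slope.
(* [al] is the derivative at 0 of the jump [modeA m]. *)
pose al : C := dU.[xl] - conjc (phase 0) * dU.[xr] - conjc (dphase 0) * c.
pose r0 := dU^`() + al *: D.
have phs := phase_slope FF F0 Fn.
have Acv : ccvg F (fun y => (modeA m y - modeA m 0) * fr y) al.
  pose proof (phase_cvg FF F0) as ph0.
  pose proof (ccvgB (ccvgB (dUP _ (lin_form_horner xl))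
    (ccvgM (ccvg_conj ph0) (dUP _ (lin_form_horner xr))))
    (ccvgM (ccvg_conj phs) (ccvg_cst c))) as H.
  apply: ccvg_near H; near=> y.
  by rewrite /modeA Uc !hornerC subr0 !conjcE; ring.
have Qcv L : lin_form L -> ccvg F (fun y => L (modeQ m y) * fr y) (L r0).
  move=> Ll; have LE U a : L (U^`() + a *: D) = L U^`() + a * L D.
    by rewrite addrC Ll addrC.
  have L0 : L (modeU m 0)^`() + modeA m 0 * L D = 0.
    by rewrite -LE -/(modeQ m 0) Q0 lin_form0.
  rewrite /r0 LE.
  pose proof (ccvgD (dUP _ (lin_form_deriv Ll)) (ccvgM Acv (ccvg_cst (L D)))) as H.
  apply: ccvg_near H; near=> y.
  rewrite /modeQ LE -[_ + modeA m y * _]subr0 -{}L0; ring.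
have [sr0 _] := auxiliary_formula h_gt0 al HD sdU; rewrite -/r0 in sr0.
have [r0' _] : r0^`() = 0 /\ r0.[xr] = 1 * r0.[xl].
  apply: (closed_flux_deriv (k := k) h_gt0) => // [|V sV].
    by rewrite conjc1 mulr1.
  pose Y y := (- I ((modeQ m y)^`() * V) +
    ((modeQ m y).[xr] - phase y * (modeQ m y).[xl]) * V.[xr]) * fr y.
  apply: (@ccvg_unique R F Y _ _ FP).
    pose proof (phase_cvg FF F0) as ph0; rewrite phase0 in ph0.
    pose proof (ccvgD (ccvgN (Qcv _ (lin_form_deriv (lin_form_int V))))
      (ccvgM (ccvgB (Qcv _ (lin_form_horner xr))
        (ccvgM ph0 (Qcv _ (lin_form_horner xl)))) (ccvg_cst V.[xr]))) as H.
    by apply: ccvg_near H; near=> y; rewrite /Y; ring.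
  pose proof (ccvgM (ccvg_real sigma_over_id) (modeU_cvg F0 FB Brillouin0 m (lin_form_int V))) as H.
  rewrite mul0r in H; apply: ccvg_near H; near=> y.
  have By : B y by near: y.
  by rewrite /Y -(bloch_eig (mode_bloch m By) sV) rmorphM; ring.
have r0c := deriv0_cst r0'; set rho := r0`_0 in r0c.
have rhoE : rho = 'i * c.
  have Ir0 : I (r0 * 1) = - conjc (dphase 0) * c.
    apply: (@ccvg_unique R F (fun y => I (modeQ m y * 1) * fr y) _ _ FP).
      exact: (Qcv _ (lin_form_int 1)).
    pose proof (modeU_cvg F0 FB Brillouin0 m (lin_form_horner xr)) as Ur.
    rewrite Uc hornerC in Ur.
    pose proof (ccvgM (ccvgN (ccvg_conj phs)) Ur) as H.
    apply: ccvg_near H; near=> y; have By : B y by near: y.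
    have [iQ _] := bloch_mean h_gt0 (mode_bloch m By).
    by rewrite mulr1 iQ phase0 subr0 !conjcE; ring.
  have h0 : h%:C != 0 by apply: contra_neq (lt0r_neq0 h_gt0) => /(congr1 (@complex.Re R)).
  apply: (mulIf h0); move: Ir0; rewrite mulr1 r0c cell_int_cst// => ->.
  rewrite /dphase phase0 mulr1 conjcE conjcR conjcI; ring.
rewrite -rhoE; have := Qcv _ (lin_form_horner xl).
by rewrite r0c hornerC.
Unshelve. all: by end_near.
Qed.

(** Consistency of the physical branch, from [sigma * I U = (1 - z) Q(xl)]
    divided by [y^2]: both factors on the right are of order [y]. *)
Lemma sigma_ph_equiv : sigma m y / y ^+ 2 @[y --> F] --> (1 : R).
Proof.
have [c [Uc [cn Ql]]] := modeQ_slope.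
pose proof (phase_slope FF F0 Fn) as phs.
have IU0 : I (modeU m 0 * 1) = c * h%:C by rewrite mulr1 Uc cell_int_cst.
pose proof (ccvgM (modeU_cvg F0 FB Brillouin0 m (lin_form_int 1))
  (ccvg_cst (conjc (c * h%:C)))) as cG.
pose proof (ccvgM (ccvgM (ccvgN phs) Ql) (ccvg_cst (conjc (c * h%:C)))) as cE.
have gE : c * h%:C * conjc (c * h%:C) = h%:C.
  have r3 (a b d : C) : a * d * (b * d) = d * (a * b * d) by ring.
  by rewrite conjcM conjcR r3 cn mulr1.
rewrite IU0 gE in cG.
have eE : - dphase 0 * ('i * c) * conjc (c * h%:C) = h%:C.
  have r3 (a b d e : C) : - (e * d) * (e * a) * (b * d) = - (e * e) * d * (a * b * d) by ring.
  by rewrite conjcM conjcR /dphase phase0 mulr1 r3 cn -expr2 sqr_i opprK mul1r mulr1.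
rewrite eE in cE.
rewrite (_ : 1 = complex.Re h%:C / complex.Re h%:C); last by rewrite /= divff// gt_eqF.
apply: (ccvg_quotient _ cG cE); last by rewrite /= gt_eqF.
near=> y; have By : B y by near: y.
have y0 : y != 0 by near: y.
have [_ iU] := bloch_mean h_gt0 (mode_bloch m By).
have -> : (sigma m y / y ^+ 2)%:C = (sigma m y)%:C * (fr y * fr y).
  by rewrite expr2 invfM !rmorphM.
have r3 (a b d e : C) : a * b * (d * e) = b * (a * d) * e by ring.
rewrite mulr1 r3 iU phase0 subr0; ring.
Unshelve. all: by end_near.
Qed.

Lemma slope_ph_equiv : slope m y / y @[y --> F] --> (2 : R).
Proof.
have [c [Uc [cn Ql]]] := modeQ_slope.
pose proof (phase_cvg FF F0) as ph0.
have dph0 : ccvg F dphase (dphase 0).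
  by apply: ccvgM; [exact: ccvg_cst|exact: ph0].
pose proof (modeU_cvg F0 FB Brillouin0 m (lin_form_horner xr)) as Ur.
rewrite Uc hornerC in Ur.
pose proof (ccvgB (ccvgM (ccvgM (ccvgN dph0) (ccvg_conj Ur)) Ql)
  (ccvgM (ccvgM (ccvg_conj dph0) Ur) (ccvg_conj Ql))) as [H _].
have lE : - dphase 0 * conjc c * ('i * c) - conjc (dphase 0) * c * conjc ('i * c) = 2.
  have r3 (a b d e : C) : - (e * d) * b * (e * a) - (- e * d) * a * (- e * b) =
    - (e * e) * 2 * (a * b * d) by ring.
  by rewrite /dphase phase0 mulr1 !conjcM conjcR conjcI r3 cn -expr2 sqr_i opprK mul1r mulr1.
rewrite lE in H; have -> : 2 = complex.Re (2 : C) by rewrite -[2]/(2%:R) raddfMn.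
move: H; apply: cvg_trans; apply: near_eq_cvg; near=> y.
transitivity (complex.Re (slopeC m y * fr y)); last by rewrite ReM /= mulr0 subr0.
by congr complex.Re; rewrite /slopeC !conjcE; ring.
Unshelve. all: by end_near.
Qed.

End LongWave.

(** The branches are ordered at 0 and, having no common positive value, keep
    this order up to the end of the Brillouin zone. *)
Lemma sigma_ph_lt_sp i : sigma (ph k) T < sigma (sp i) T.
Proof.
have T0 := T_gt0; rewrite ltNge; apply/negP => Tle.
pose f x := sigma (sp i) x - sigma (ph k) x.
have B0T x : x \in `[0, T] -> B x.
  by rewrite in_itv /= => /andP[x0 xT]; apply/BrillouinP; rewrite xT andbT; lra.
have fc : {within `[0, T], continuous f}.
  apply/subspace_continuousP => x x0T.
  have FB : \forall y \near within `[0, T] (nbhs x), B y.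
    by apply: filterS (withinT _ (nbhs_filter x)) => y; exact: B0T.
  have Fx : within `[0, T] (nbhs x) --> x by exact: cvg_within.
  by apply: cvgB; exact: sigma_cvg Fx FB (B0T _ x0T) _.
have f0 : 0 < f 0 by rewrite /f (sigma_ph0 Hm) subr0 (sigma_sp0 Hm).
have [|c c0T fc0] := IVT (v := 0) (ltW T0) fc.
  have fT : f T <= 0 by rewrite subr_le0.
  by rewrite ge_min le_max (ltW f0) fT orbT.
have c0 : c != 0 by apply: contra_eq_neq fc0 => ->; rewrite gt_eqF.
have e : sigma (sp i) c = sigma (ph k) c by apply/eqP; rewrite -subr_eq0 -/(f c) fc0.
by have := sigma_inj (B0T _ c0T) e (sigma_gt0 _ (B0T _ c0T) c0).
Qed.

Lemma sigma_rank1 m x : k = 0%N -> B x -> sigma m x * h ^+ 2 = 2 - 2 * cos (x * h).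
Proof.
move=> k0 Bx.
have := bloch_rank1 h_gt0 k0 (mode_bloch m Bx) (modeU_neq0 m Bx).
have -> : (1 - phase x) * (1 - conjc (phase x)) =
    1 - phase x - conjc (phase x) + phase x * conjc (phase x) by ring.
rewrite phase_unit -rmorphXn -rmorphM => /(congr1 (@complex.Re R)) /= ->.
rewrite /phase /expi /=; ring.
Qed.

End Modes.

(** * From eigenvalues to discrete frequencies *)

Section DiscreteFrequency.
Context {R : realType} (dt : R).
Hypothesis dt_gt0 : 0 < dt.
Implicit Types (sg s : R -> R) (F : set_system R).

Lemma omega_derive sg (x d : R) : x != 0 -> is_derive x 1 sg d ->
  0 < sg x < 4 / dt ^+ 2 ->
  is_derive x 1 (omega dt sg)
    (Num.sg x * (d / (2 * Num.sqrt (sg x) * Num.sqrt (1 - sg x * dt ^+ 2 / 4)))).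
Proof.
move=> x0 dsg /andP[s0 s4].
have q2 : (Num.sqrt (sg x) * dt / 2) ^+ 2 = sg x * dt ^+ 2 / 4.
  by rewrite expr_div_n exprMn sqr_sqrtr ?ltW//; congr (_ / _); ring.
have q1 : -1 < Num.sqrt (sg x) * dt / 2 < 1.
  have q0 : 0 <= Num.sqrt (sg x) * dt / 2.
    by rewrite divr_ge0// mulr_ge0 ?sqrtr_ge0// ltW.
  rewrite (lt_le_trans _ q0) ?ltrN10//= -(@ltr_pXn2r _ 2) ?nnegrE//.
  rewrite q2 expr1n; move: s4; rewrite ltr_pdivlMr ?exprn_gt0//; lra.
have d1 := @is_derive1_comp R Num.sqrt sg x _ _ (is_derive1_sqrt s0) dsg.
have d2 := @is_derive1_comp R (fun z => z * (dt / 2)) _ x _ _ (is_derive_mulr _ _) d1.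
rewrite -mulrA in q1 q2.
have d3 := @is_derive1_comp R asin _ x _ _ (is_derive1_asin q1) d2.
have d4 := @is_derive1_comp R (fun z => z * (Num.sg x * (2 / dt))) _ x _ _
  (is_derive_mulr _ _) d3.
have dE : Num.sg x * (2 / dt) * ((Num.sqrt (1 - (Num.sqrt (sg x) * (dt / 2)) ^+ 2))^-1 *
    (dt / 2 * ((2 * Num.sqrt (sg x))^-1 * d))) =
    Num.sg x * (d / (2 * Num.sqrt (sg x) * Num.sqrt (1 - sg x * dt ^+ 2 / 4))).
  have n1 : Num.sqrt (sg x) != 0 by rewrite sqrtr_eq0 -ltNge.
  have n2 : Num.sqrt (1 - sg x * dt ^+ 2 / 4) != 0.
    rewrite sqrtr_eq0 -ltNge subr_gt0.
    move: s4; rewrite ltr_pdivlMr ?exprn_gt0//; lra.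
  have n3 : dt != 0 by rewrite gt_eqF.
  by rewrite q2; move: n1 n2; move: (Num.sqrt _) (Num.sqrt _) => ? ? ? ?; field; apply/and3P.
apply: (near_eq_is_derive _ (is_derive_eq d4 dE)).
have sgx : \forall y \near x, Num.sg y = Num.sg x.
  move: x0; rewrite neq_lt => /orP[xlt|xgt].
    by near=> y; rewrite (ltr0_sg xlt) ltr0_sg//; near: y; exact: lt_nbhsl.
  by near=> y; rewrite (gtr0_sg xgt) gtr0_sg//; near: y; exact: lt_nbhsr.
near=> y; rewrite /omega /= (_ : Num.sg y = Num.sg x); last by near: y.
by rewrite mulrA mulrC.
Unshelve. all: by end_near.
Qed.

(** At the end 1 of its domain [asin] is not differentiable; its left continuity
    there follows from the strict monotonicity of the sine. *)
Lemma asin_cvg1 F (q : R -> R) : Filter F -> q y @[y --> F] --> (1 : R) ->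
  (\forall y \near F, q y <= 1) -> asin (q y) @[y --> F] --> pi / 2.
Proof.
move=> FF q1 qle; apply/cvgrPdist_le => e e0.
pose d := Num.min e (pi / 2).
have pi0 : 0 < pi :> R by exact: pi_gt0.
have d0 : 0 < d by rewrite lt_min e0 divr_gt0.
have dpi : d <= pi / 2 by rewrite ge_min lexx orbT.
have I1 : pi / 2 - d \in `[- (pi / 2), pi / 2] by rewrite in_itv /=; apply/andP; split; lra.
have I2 : pi / 2 \in `[- (pi / 2), pi / 2 : R] by rewrite in_itv /=; apply/andP; split; lra.
have sd : sin (pi / 2 - d) < 1.
  by rewrite -[X in _ < X]sin_pihalf ltr_sin//; lra.
have qgt := cvgr_gt _ q1 _ sd.
have q0 := cvgr_gt _ q1 _ (ltr01 : 0 < 1 :> R).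
near=> y.
have q0y : 0 < q y by near: y; exact: q0.
have q1y : q y <= 1 by near: y.
have qdy : sin (pi / 2 - d) < q y by near: y; exact: qgt.
have qI : -1 <= q y <= 1 by apply/andP; split; lra.
have qI' : q y \in `[-1, 1] by rewrite in_itv.
have := asin_lepi2 qI; have := asin_geNpi2 qI => a1 a2.
have : pi / 2 - d < asin (q y).
  by rewrite -ltr_sin ?asinK// in_itv /= a1 a2.
have de : d <= e by rewrite ge_min lexx.
by rewrite ger0_norm; lra.
Unshelve. all: by end_near.
Qed.

(** Where [asin] and the square root are both smooth, the group velocity is a
    bounded multiple of the derivative of the branch. *)
Lemma group_velocity_zero F sg s (sg0 : R) : Filter F ->
  (\forall y \near F, (y : R) != 0 /\ is_derive (y : R) 1 sg (s y)) ->
  sg y @[y --> F] --> sg0 -> s y @[y --> F] --> (0 : R) -> 0 < sg0 < 4 / dt ^+ 2 ->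
  group_velocity_cvg (omega dt sg) F 0.
Proof.
move=> FF dF sgF sF /andP[s0 s4].
have Fs0 := cvgr_gt _ sgF _ s0; have Fs4 := cvgr_lt _ sgF _ s4.
have D : \forall y \near F, is_derive (y : R) 1 (omega dt sg)
    (Num.sg y * (s y / (2 * Num.sqrt (sg y) * Num.sqrt (1 - sg y * dt ^+ 2 / 4)))).
  near=> y.
  have [y0 dy] : (y : R) != 0 /\ is_derive (y : R) 1 sg (s y) by near: y.
  apply: omega_derive => //; apply/andP; split; near: y; [exact: Fs0|exact: Fs4].
split; first by apply: filterS D => y Dy; exact: ex_derive.
pose den y := 2 * Num.sqrt (sg y) * Num.sqrt (1 - sg y * dt ^+ 2 / 4).
pose c0 := 2 * Num.sqrt sg0 * Num.sqrt (1 - sg0 * dt ^+ 2 / 4).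
have c0_neq0 : c0 != 0.
  rewrite !mulf_neq0// sqrtr_eq0 -ltNge// subr_gt0.
  move: s4; rewrite ltr_pdivlMr ?exprn_gt0//; lra.
have denF : den y @[y --> F] --> c0.
  have sqF := continuous_cvg FF (@sqrt_continuous R _) sgF.
  have inF : 1 - sg y * dt ^+ 2 / 4 @[y --> F] --> 1 - sg0 * dt ^+ 2 / 4.
    apply: cvgB; first exact: cvg_cst.
    by apply: cvgM; [apply: cvgM => //; exact: cvg_cst|exact: cvg_cst].
  have sq2F := continuous_cvg FF (@sqrt_continuous R _) inF.
  by apply: cvgM; [apply: cvgM => //; exact: cvg_cst|].
have g0 : `|s y / den y| @[y --> F] --> (0 : R).
  rewrite -(normr0 R) -(mul0r c0^-1).
  by apply: cvg_norm; apply: cvgM => //; exact: cvgV.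
apply: cvg_dist_le g0 _; near=> y.
have Dy : is_derive y 1 (omega dt sg) (Num.sg y * (s y / den y)) by near: y; exact: D.
rewrite subr0 derive1E (@derive_val _ _ _ _ _ _ _ Dy) normrM ler_piMl//.
by rewrite normr_sg lern1; case: eqP.
Unshelve. all: by end_near.
Qed.

(** At the origin the square root is singular: after division by [|y|] the
    velocity is [(s / y) / (2 sqrt (sg / y^2) sqrt (1 - sg dt^2 / 4))]. *)
Lemma group_velocity_one F sg s : Filter F -> F --> (0 : R) ->
  (\forall y \near F, (y : R) != 0 /\ is_derive (y : R) 1 sg (s y)) ->
  sg y / y ^+ 2 @[y --> F] --> (1 : R) -> s y / y @[y --> F] --> (2 : R) ->
  group_velocity_cvg (omega dt sg) F 1.
Proof.
move=> FF F0 dF sg2 s1.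
have F0' : y @[y --> F] --> (0 : R) by [].
have y2 : y ^+ 2 @[y --> F] --> (0 : R).
  by rewrite -(mul0r 0); under eq_cvg do rewrite expr2; exact: cvgM.
have sgF : sg y @[y --> F] --> (0 : R).
  rewrite -(mulr0 1); have H : sg y / y ^+ 2 * y ^+ 2 @[y --> F] --> (1 * 0 : R).
    exact: cvgM.
  move: H; apply: cvg_trans; apply: near_eq_cvg; near=> y.
  have [y0 _] : (y : R) != 0 /\ is_derive (y : R) 1 sg (s y) by near: y.
  by rewrite divfK// expf_neq0.
have s4 : 0 < 4 / dt ^+ 2 by rewrite divr_gt0 ?exprn_gt0.
have Fs4 := cvgr_lt _ sgF _ s4.
have Fs0 := cvgr_gt _ sg2 _ (ltr01 : 0 < 1 :> R).
have D : \forall y \near F, 0 < sg y /\ (y : R) != 0 /\ is_derive (y : R) 1 (omega dt sg)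
    (Num.sg y * (s y / (2 * Num.sqrt (sg y) * Num.sqrt (1 - sg y * dt ^+ 2 / 4)))).
  near=> y.
  have [y0 dy] : (y : R) != 0 /\ is_derive (y : R) 1 sg (s y) by near: y.
  have sy : 0 < sg y.
    have : 0 < sg y / y ^+ 2 by near: y; exact: Fs0.
    by rewrite pmulr_lgt0// invr_gt0 exprn_even_gt0.
  split=> //; split=> //.
  apply: omega_derive => //; apply/andP; split=> //; near: y; exact: Fs4.
split; first by apply: filterS D => y [_ [_ Dy]]; exact: ex_derive.
pose den y := 2 * Num.sqrt (sg y / y ^+ 2) * Num.sqrt (1 - sg y * dt ^+ 2 / 4).
have denF : den y @[y --> F] --> (2 : R).
  have sqF := continuous_cvg FF (@sqrt_continuous R _) sg2.
  have inF : 1 - sg y * dt ^+ 2 / 4 @[y --> F] --> 1 - 0 * dt ^+ 2 / 4.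
    apply: cvgB; first exact: cvg_cst.
    by apply: cvgM; [apply: cvgM => //; exact: cvg_cst|exact: cvg_cst].
  have sq2F := continuous_cvg FF (@sqrt_continuous R _) inF.
  rewrite !mul0r subr0 sqrtr1 in sq2F; rewrite sqrtr1 in sqF.
  rewrite (_ : 2 = 2 * 1 * 1); last by rewrite !mulr1.
  by apply: cvgM; [apply: cvgM => //; exact: cvg_cst|].
have H : s y / y / den y @[y --> F] --> (2 / 2 : R).
  by apply: cvgM => //; apply: cvgV.
rewrite (_ : 1 = 2 / 2 :> R); last by rewrite divff.
move: H; apply: cvg_trans; apply: near_eq_cvg; near=> y.
have [sy [y0 Dy]] : 0 < sg y /\ (y : R) != 0 /\ is_derive (y : R) 1 (omega dt sg)
    (Num.sg y * (s y / (2 * Num.sqrt (sg y) * Num.sqrt (1 - sg y * dt ^+ 2 / 4)))).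
  by near: y; exact: D.
rewrite derive1E (@derive_val _ _ _ _ _ _ _ Dy) /den.
have -> : Num.sqrt (sg y / y ^+ 2) = Num.sqrt (sg y) / `|y|.
  by rewrite sqrtrM ?(ltW sy)// -exprVn sqrtr_sqr normfV.
have ny : `|y| / y = Num.sg y by rewrite normrEsg mulfK.
rewrite -ny; move: (Num.sqrt _) (Num.sqrt _) `|y| => a b n.
by rewrite !invfM invrK; ring.
Unshelve. all: by end_near.
Qed.

(** The proviso in terms of the eigenvalue: a branch reaching the stability bound
    has limit frequency [pi / dt], since then [asin] is taken at 1. *)
Lemma omega_lim F sg (sg0 : R) : ProperFilter F ->
  (\forall y \near F, (y : R) != 0 /\ 0 <= sg y <= 4 / dt ^+ 2) ->
  sg y @[y --> F] --> sg0 -> sg0 = 4 / dt ^+ 2 ->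
  lim (`|omega dt sg y| @[y --> F]) = pi / dt.
Proof.
move=> FF nF sgF s4; apply/cvg_lim => //.
pose proof (continuous_cvg _ (@sqrt_continuous R _) sgF) as sqF.
have sq0 : Num.sqrt sg0 * dt / 2 = 1.
  rewrite s4 (_ : 4 / dt ^+ 2 = (2 / dt) ^+ 2); last first.
    by rewrite expr_div_n; congr (_ / _); ring.
  rewrite sqrtr_sqr gtr0_norm ?divr_gt0//; field.
  by rewrite gt_eqF.
have qF : Num.sqrt (sg y) * dt / 2 @[y --> F] --> (1 : R).
  have : Num.sqrt (sg y) * dt / 2 @[y --> F] --> Num.sqrt sg0 * dt / 2.
    by apply: cvgM; [apply: cvgM => //; exact: cvg_cst|exact: cvg_cst].
  by rewrite sq0.
have q1 : \forall y \near F, Num.sqrt (sg y) * dt / 2 <= 1.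
  near=> y; have [_ /andP[_ sy]] : (y : R) != 0 /\ 0 <= sg y <= 4 / dt ^+ 2 by near: y.
  rewrite -[leRHS]sq0 ler_pM2r// ler_pM2r// ler_sqrt ?s4//.
  by rewrite divr_ge0 ?exprn_ge0// ltW.
pose proof (asin_cvg1 _ qF q1) as aF.
have H : 2 / dt * asin (Num.sqrt (sg y) * dt / 2) @[y --> F] --> 2 / dt * (pi / 2).
  by apply: cvgM; [exact: cvg_cst|exact: aF].
rewrite (_ : pi / dt = 2 / dt * (pi / 2)); last by field; rewrite gt_eqF.
move: H; apply: cvg_trans; apply: near_eq_cvg; near=> y.
have [y0 _] : (y : R) != 0 /\ 0 <= sg y <= 4 / dt ^+ 2 by near: y.
have e2 : `|2 / dt| = 2 / dt by rewrite gtr0_norm// divr_gt0.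
rewrite /omega normrM [`|Num.sg y * _|]normrM normr_sg y0 mul1r e2.
congr (_ * _); rewrite ger0_norm//.
have qy : Num.sqrt (sg y) * dt / 2 <= 1 by near: y; exact: q1.
have q0 : 0 <= Num.sqrt (sg y) * dt / 2 by rewrite divr_ge0// mulr_ge0 ?sqrtr_ge0// ltW.
have qI : -1 <= Num.sqrt (sg y) * dt / 2 <= 1 by rewrite qy (le_trans _ q0)// lerN10.
have pi0 : 0 < pi :> R by exact: pi_gt0.
rewrite leNgt; apply/negP => an.
have : sin (asin (Num.sqrt (sg y) * dt / 2)) < sin 0.
  have I1 : asin (Num.sqrt (sg y) * dt / 2) \in `[- (pi / 2), pi / 2].
    by rewrite in_itv /= asin_geNpi2// asin_lepi2.
  have I2 : (0 : R) \in `[- (pi / 2), pi / 2].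
    by rewrite in_itv /=; apply/andP; split; lra.
  by rewrite (ltr_sin I1 I2).
by rewrite asinK ?in_itv//= sin0 ltNge q0.
Unshelve. all: by end_near.
Qed.

End DiscreteFrequency.

Lemma group_velocity_id (R : realType) (w : R -> R) (F : set_system R) : Filter F ->
  (\forall y \near F, \forall z \near y, z = w z) -> group_velocity_cvg w F 1.
Proof.
move=> FF wF.
have D : \forall y \near F, is_derive (y : R) 1 w 1.
  by apply: filterS wF => y wy; apply: near_eq_is_derive wy _; exact: is_derive_id.
split; first by apply: filterS D => y Dy; exact: ex_derive.
apply: cvg_near_cst; apply: filterS D => y Dy.
by rewrite derive1E (@derive_val _ _ _ _ _ _ _ Dy).
Qed.

(** For [dt = h] and piecewise constants time and space errors cancel:
    [sqrt sigma * h / 2 = |sin (y h / 2)|], which [asin] inverts. *)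
Lemma omega_rank1 (R : realType) (h : R) (sg : R -> R) (y : R) : 0 < h ->
  - (pi / h) < y < pi / h -> y != 0 -> 0 <= sg y ->
  sg y * h ^+ 2 = 2 - 2 * cos (y * h) -> omega h sg y = y.
Proof.
move=> h0 /andP[y1 y2] y0 s0 sE; rewrite /omega.
pose t := `|y| * h / 2.
have t0 : 0 <= t by rewrite divr_ge0// mulr_ge0// ltW.
have tpi : t <= pi / 2.
  rewrite /t ler_pM2r// -ler_pdivlMr// ler_norml; apply/andP; split; exact: ltW.
have pi0 : 0 < pi :> R by exact: pi_gt0.
have sin0 : 0 <= sin t by apply: sin_ge0_pi; apply/andP; split=> //; lra.
have ce : cos (y * h) = 1 - 2 * sin t ^+ 2.
  have -> : cos (y * h) = cos (t + t).
    have -> : t + t = `|y| * h by rewrite /t; lra.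
    by case: (ger0P y) => // _; rewrite mulNr cosN.
  by rewrite cosD -!expr2 cos2sin2; ring.
have -> : Num.sqrt (sg y) * h / 2 = sin t.
  have q0 : 0 <= Num.sqrt (sg y) * h / 2.
    by rewrite divr_ge0// mulr_ge0 ?sqrtr_ge0// ltW.
  apply/eqP; rewrite -(eqrXn2 (isT : 0 < 2)%N q0 sin0).
  rewrite expr_div_n exprMn sqr_sqrtr// sE ce; apply/eqP; by field.
rewrite sinK; last by rewrite in_itv /= tpi andbT; lra.
rewrite /t [RHS]numEsg; field.
by rewrite gt_eqF.
Qed.

(** * Limits of the group velocities *)

Section GroupVelocities.
Context {R : realType} (k : nat) (h dt : R) (Km1 K0 Kp1 : 'M[R]_k.+1)
  (sigma : mode k -> R -> R) (v : mode k -> R -> 'cV[R[i]]_k.+1).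
Hypothesis h_gt0 : 0 < h.
Hypothesis dt_gt0 : 0 < dt.
Hypothesis HK : stiffness_blocks h Km1 K0 Kp1.
Hypothesis Hm : eigenbranches h Km1 K0 Kp1 sigma v.
Hypothesis Hstab : forall m xi, Brillouin h xi -> sigma m xi <= 4 / dt ^+ 2.
Local Notation T := (pi / h).
Implicit Types (F : set_system R) (m : mode k).

(** The one-sided limits run inside the open Brillouin zone and avoid 0, where
    the sign in [omega] jumps. *)
Definition inner F (x : R) := F --> x /\ \forall y \near F, - T < y < T /\ y != 0.

Lemma inner_end : inner T^'- T /\ inner (- T)^'+ (- T).
Proof.
have T0 := T_gt0 h_gt0; split; split.
- exact: cvg_at_left_filter cvg_id.
- near=> y.
  have y0 : 0 < y by near: y; exact: nbhs_left_gt.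
  have yT : y < T by near: y; exact: nbhs_left_lt.
  by rewrite yT gt_eqF// andbT; split=> //; lra.
- exact: cvg_at_right_filter cvg_id.
- near=> y.
  have y0 : y < 0 by near: y; apply: nbhs_right_lt; lra.
  have yT : - T < y by near: y; exact: nbhs_right_gt.
  by rewrite yT lt_eqF//; split=> //=; lra.
Unshelve. all: by end_near.
Qed.

Lemma inner_zero : inner 0^'+ 0 /\ inner 0^'- 0.
Proof.
have T0 := T_gt0 h_gt0; split; split.
- exact: cvg_at_right_filter cvg_id.
- near=> y.
  have y0 : 0 < y by near: y; exact: nbhs_right_gt.
  have yT : y < T by near: y; exact: nbhs_right_lt.
  by rewrite yT gt_eqF// andbT; split=> //; lra.
- exact: cvg_at_left_filter cvg_id.
- near=> y.
  have y0 : y < 0 by near: y; exact: nbhs_left_lt.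
  have yT : - T < y by near: y; apply: nbhs_left_gt; lra.
  by rewrite yT lt_eqF//; split=> //=; lra.
Unshelve. all: by end_near.
Qed.

Lemma inner_Brillouin F x : Filter F -> inner F x -> \forall y \near F, Brillouin h y.
Proof.
move=> FF [_]; apply: filterS => y [/andP[y1 y2] _].
by apply/BrillouinP; rewrite !ltW.
Qed.

(** [phase] is real exactly at 0 and at the ends of the zone, and there
    [slope_real_phase] makes the branch stationary. *)
Lemma group_velocity_edge m F x : Filter F -> inner F x -> Brillouin h x ->
  conjc (phase h x) = phase h x -> 0 < sigma m x -> sigma m x != 4 / dt ^+ 2 ->
  group_velocity_cvg (omega dt (sigma m)) F 0.
Proof.
move=> FF Fx Bx zr s0 s4; have FB := inner_Brillouin FF Fx; case: (Fx) => Fx0 nF.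
have [D HD] := left_trace_dual_exists k h_gt0.
apply: (@group_velocity_zero _ dt dt_gt0 F (sigma m) (slope h v D m) (sigma m x)).
- apply: filterS nF => y [yT y0]; split=> //.
  exact: (sigma_derive h_gt0 HK Hm HD).
- exact: (sigma_cvg h_gt0 Hm Fx0 FB Bx).
- rewrite -(slope_real_phase h_gt0 HK Hm HD Bx (lt0r_neq0 s0) zr).
  exact: (slope_cvg h_gt0 Hm FF Fx0 FB Bx).
- by rewrite s0 lt_neqAle s4 Hstab.
Qed.

Lemma group_velocity_proviso m F x : ProperFilter F -> inner F x -> Brillouin h x ->
  conjc (phase h x) = phase h x -> 0 < sigma m x ->
  lim (`|omega dt (sigma m) y| @[y --> F]) <> pi / dt ->
  group_velocity_cvg (omega dt (sigma m)) F 0.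
Proof.
move=> FF Fx Bx zr s0 nlim.
have FB : \forall y \near F, Brillouin h y by exact: inner_Brillouin Fx.
apply: (group_velocity_edge _ Fx Bx zr s0); apply/eqP => s4; apply: nlim.
pose proof (sigma_cvg (m := m) h_gt0 Hm Fx.1 FB Bx) as sF.
apply: (omega_lim dt_gt0 FF _ sF s4).
near=> y.
have [yT y0] : - T < y < T /\ y != 0 by near: y; exact: Fx.2.
have By : Brillouin h y by near: y.
by split=> //; rewrite (sigma_ge0 Hm) ?Hstab.
Unshelve. all: by end_near.
Qed.

Lemma Brillouin_T : Brillouin h T /\ Brillouin h (- T).
Proof.
have T0 := T_gt0 h_gt0.
by split; apply/BrillouinP; rewrite lexx ?andbT /=; lra.
Qed.

Lemma phase_real_T : conjc (phase h T) = phase h T /\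
  conjc (phase h (- T)) = phase h (- T).
Proof. by rewrite phaseT// phaseNT// rmorphN1. Qed.

(** For [k > 0] the physical branch stays below the spurious branch of index 0,
    itself below the bound; for [k = 0] its end value is [4 / h^2]. *)
Lemma sigma_ph_T : ~~ ((k == 0%N) && (dt == h)) -> sigma (ph k) T != 4 / dt ^+ 2.
Proof.
have [BT _] := Brillouin_T.
have [D HD] := left_trace_dual_exists k h_gt0.
have [k0|k0] := eqVneq k 0%N; last first.
  move=> _; have i : 'I_k by exists 0%N; rewrite lt0n.
  rewrite lt_eqF//; apply: lt_le_trans (Hstab (sp i) BT).
  exact: (sigma_ph_lt_sp h_gt0 HK Hm HD).
rewrite /=; apply: contra_neq => e.
have := sigma_rank1 h_gt0 HK Hm HD (ph k) k0 BT.
rewrite divfK ?gt_eqF// cospi e => s.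
have : h ^+ 2 = dt ^+ 2.
  have : 4 * h ^+ 2 = 4 * dt ^+ 2.
    have d0 : dt ^+ 2 != 0 by rewrite expf_neq0 ?gt_eqF.
    have -> : 4 * h ^+ 2 = (4 / dt ^+ 2 * h ^+ 2) * dt ^+ 2 by field; rewrite gt_eqF.
    by rewrite s; ring.
  lra.
by move/eqP; rewrite eqrXn2 ?ltW// => /eqP.
Qed.

(** Away from the stability bound the end of the zone is a critical point; the
    exceptional case is the exact dispersion relation of [omega_rank1]. *)
Lemma group_velocity_ph_end F x : Filter F -> inner F x ->
  (x = T \/ x = - T) ->
  group_velocity_cvg (omega dt (sigma (ph k))) F
    (if (k == 0%N) && (dt == h) then 1 else 0).
Proof.
move=> FF Fx xT.
have [D HD] := left_trace_dual_exists k h_gt0.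
have T0 := T_gt0 h_gt0.
have [BT BNT] := Brillouin_T; have [zT zNT] := phase_real_T.
have [Bx [zx [sx x0]]] : Brillouin h x /\ conjc (phase h x) = phase h x /\
    sigma (ph k) x = sigma (ph k) T /\ x != 0.
  case: xT => ->; first by rewrite gt_eqF.
  by rewrite (sigma_even Hm)// oppr_eq0 gt_eqF.
case: ifPn => [/andP[/eqP k0 /eqP dth]|nk]; last first.
  apply: (group_velocity_edge _ Fx Bx zx); last by rewrite sx sigma_ph_T.
  exact: (sigma_gt0 h_gt0 HK Hm HD).
apply: group_velocity_id; apply: filterS Fx.2 => y [yT y0].
have nT : \forall z \near y, - T < z < T.
  have : y \in `](- T), T[ by rewrite in_itv.
  by move=> /near_in_itvoo; apply: filterS => z; rewrite in_itv.
have n0 : \forall z \near y, z != 0.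
  have [y_lt|y_gt|y_eq] := ltgtP y 0; last by rewrite y_eq eqxx in y0.
    by apply: filterS (lt_nbhsl y_lt) => z zl; rewrite lt_eqF.
  by apply: filterS (lt_nbhsr y_gt) => z zl; rewrite gt_eqF.
near=> z; rewrite dth omega_rank1 //; [by near: z|by near: z| |].
  apply: (sigma_ge0 Hm); apply/BrillouinP.
  have /andP[z1 z2] : - T < z < T by near: z.
  by rewrite !ltW.
apply: (sigma_rank1 h_gt0 HK Hm HD) => //; apply/BrillouinP.
have /andP[z1 z2] : - T < z < T by near: z.
by rewrite !ltW.
Unshelve. all: by end_near.
Qed.

Lemma group_velocity_ph0 : group_velocity_cvg (omega dt (sigma (ph k))) 0^' 1.
Proof.
have T0 := T_gt0 h_gt0.
have [D HD] := left_trace_dual_exists k h_gt0.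
apply: (@group_velocity_one _ dt dt_gt0 _ _ (slope h v D (ph k))).
- exact: nbhs_dnbhs.
- have nT : \forall y \near 0^', - T < y < T.
    apply: nbhs_dnbhs; have : (0 : R) \in `](- T), T[ by rewrite in_itv /= oppr_lt0 T0.
    by move=> /near_in_itvoo; apply: filterS => z; rewrite in_itv.
  near=> y; split; first by near: y; exact: nbhs_dnbhs_neq.
  by apply: (sigma_derive h_gt0 HK Hm HD); near: y.
- exact: (sigma_ph_equiv h_gt0 HK Hm HD).
- exact: (slope_ph_equiv h_gt0 HK Hm HD).
Unshelve. all: by end_near.
Qed.

End GroupVelocities.

Theorem theorem3p3 (R : realType) (k : nat) (h dt : R)
    (Km1 K0 Kp1 : 'M[R]_k.+1)
    (sigma : mode k -> R -> R) (v : mode k -> R -> 'cV[R[i]]_k.+1)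
    (h_gt0 : 0 < h) (dt_gt0 : 0 < dt)
    (HK : stiffness_blocks h Km1 K0 Kp1)
    (Hmodes : eigenbranches h Km1 K0 Kp1 sigma v)
    (Hstab : forall m xi, Brillouin h xi -> sigma m xi <= 4 / dt ^+ 2) :
  let w_ph := omega dt (sigma (ph k)) in
  let w_sp i := omega dt (sigma (sp i)) in
  let v_end : R := if (k == 0%N) && (dt == h) then 1 else 0 in
  (group_velocity_cvg w_ph 0^' 1 /\
   group_velocity_cvg w_ph (pi / h)^'- v_end /\
   group_velocity_cvg w_ph (- (pi / h))^'+ v_end) /\
  (forall i : 'I_k,
     (lim (`|w_sp i xi| @[xi --> 0^'+]) <> pi / dt ->
        group_velocity_cvg (w_sp i) 0^'+ 0) /\
     (lim (`|w_sp i xi| @[xi --> 0^'-]) <> pi / dt ->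
        group_velocity_cvg (w_sp i) 0^'- 0) /\
     (lim (`|w_sp i xi| @[xi --> (pi / h)^'-]) <> pi / dt ->
        group_velocity_cvg (w_sp i) (pi / h)^'- 0) /\
     (lim (`|w_sp i xi| @[xi --> (- (pi / h))^'+]) <> pi / dt ->
        group_velocity_cvg (w_sp i) (- (pi / h))^'+ 0)).
Proof.
move=> w_ph w_sp v_end.
have [D HD] := left_trace_dual_exists k h_gt0.
have T0 := T_gt0 h_gt0.
have [iT iNT] := inner_end h_gt0; have [i0p i0m] := inner_zero h_gt0.
have [BT BNT] := Brillouin_T h_gt0; have [zT zNT] := phase_real_T h_gt0.
have z0 : conjc (phase h 0) = phase h 0 by rewrite phase0 conjc1.
split.
  split; first exact: (group_velocity_ph0 h_gt0 dt_gt0 HK Hmodes).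
  split.
    by apply: (group_velocity_ph_end h_gt0 dt_gt0 HK Hmodes Hstab _ iT); left.
  by apply: (group_velocity_ph_end h_gt0 dt_gt0 HK Hmodes Hstab _ iNT); right.
move=> i; have prov := group_velocity_proviso h_gt0 dt_gt0 HK Hmodes Hstab (m := sp i).
have s0 := sigma_sp0 Hmodes i.
have sT x : Brillouin h x -> x != 0 -> 0 < sigma (sp i) x.
  by move=> Bx x0; exact: (sigma_gt0 h_gt0 HK Hmodes HD).
split; first exact: (prov _ _ _ i0p (Brillouin0 h_gt0) z0 s0).
split; first exact: (prov _ _ _ i0m (Brillouin0 h_gt0) z0 s0).
split; first by apply: (prov _ _ _ iT BT zT); apply: sT => //; rewrite gt_eqF.
by apply: (prov _ _ _ iNT BNT zNT); apply: sT => //; rewrite oppr_eq0 gt_eqF.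
Qed.
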